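(* For any formal ternary law $(\iota,\Psi,F_t)$ over a graded $\mathbb Z[1/2]$-algebra $R$, the series $$\mu(x,y):=f([1/2](x),y)\in R[[x,y]]$$ is a formal group law over $R$.
   Context: Graded rings are commutative. Over a graded $\mathbb Z[1/2]$-algebra $R$: Framed involution. A framed involution $(\iota,\Psi)$ over $R$ is a power series $\Psi(t)=t+O(t^2)\in R[[t]]$, $|t|=-2$, homogeneous of degree $-2$, with $\iota(t):=t-2\Psi(t)$ satisfying $\iota(\iota(t))=t$. (Over general graded rings one imposes the ''$2$-saturated'' version of this equation and of the axioms below, i.e. the coefficients must satisfy all polynomial relations some $2$-power multiple of which lies in the ideal generated by the stated ones; over $\mathbb Z[1/2]$-algebras this is the same.) Series. An $(m,n)$-series over $R$ is an element $G_t=1+\sum_{l=1}^mG_l(x_1,\dots,x_n)t^l$ of $R[[x_1,\dots,x_n]][t]$ homogeneous of degree $0$, where $|x_i|=-2$, $|t|=2$. When $G_t(0,\dots,0)=1$, write $G_t=\prod_i(1+r_it)$ in a splitting algebra. Substitution is rootwise: $F_t(G_t,u,v):=\prod_iF_t(r_i,u,v)$. For $\Phi(x)=x+O(x^2)$ homogeneous of degree $-2$, the transport is $(\Phi_*G)_t=\prod_i\bigl(1+\Phi(r_i(\Phi^{-1}(x_1),\dots,\Phi^{-1}(x_n)))t\bigr)$. Formal ternary law. A formal ternary law (FTL) over $R$ with framed involution $(\iota,\Psi)$ is a $(4,3)$-series $F_t(x,y,z)=1+\sum_{l=1}^4F_lt^l$ over $R$ such that: (1) $F_t(x,0,0)=(1+xt)^2(1+\iota(x)t)^2$;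 (2) $F_t$ is symmetric in $x,y,z$; (3) $F_t(F_t(x,y,z),u,v)=F_t(x,F_t(y,z,u),v)$; (4) $\widehat F_t:=\Psi_*F_t$ satisfies $\widehat F_t(-x,y,z)=\widehat F_{-t}(x,y,z)$; (5) $F_t(x,x,y)=(1+yt)^2(1+S(x,y)t+P(x,y)t^2)$ for some $S,P\in R[[x,y]]$. The series $B,f,[2],[1/2]$. Here $S=F_1(x,x,y)-2y$ and $P=F_2(x,x,y)-2yS-y^2$. The series $D:=S^2-4P$ is divisible by $x^2$ and $\equiv16x^2$ mod $(x,y)^3$, so it has a unique square root $\sqrt D=4x\sqrt{D/(16x^2)}\equiv4x$ mod $(x,y)^2$ (binomial series). Put $B(x,y):=\tfrac12(S-\sqrt D)$, so $B\equiv-2x-y$ mod $(x,y)^2$; $f(x,y):=B(\iota(x),\iota(y))$; $[2](x):=f(x,0)\equiv2x$ mod $x^2$; and $[1/2](x)$ is the compositional inverse of $[2](x)$. *)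

(* Defs.v *)
From HB Require Import structures.
From mathcomp Require Import all_boot all_order all_fingroup all_algebra.
From mathcomp Require Import ring zify.
From mathcomp Require Import boolp ssrcomplements mpoly.

Set Implicit Arguments.
Unset Strict Implicit.
Unset Printing Implicit Defensive.

Import Order.TTheory GRing.Theory Num.Theory.

Local Open Scope ring_scope.

(* The formal power series ring R[[x_0, ..., x_(n-1)]]: a series is its family
   of coefficients, indexed by the monomials 'X_{1..n} of multinomials. *)
Record mps (R : Type) (n : nat) := MPS { mps_coef :> 'X_{1..n} -> R }.

Notation "{ 'mps' R [ n ] }" := (mps R n)
  (at level 0, R at level 2, n at level 2, format "{ 'mps'  R [ n ] }").

Lemma mpsP (R : Type) (n : nat) (f g : mps R n) : f =1 g -> f = g.
Proof. by case: f g => f [g] /= /funext ->. Qed.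

HB.instance Definition _ (R : Type) (n : nat) := gen_eqMixin (mps R n).
HB.instance Definition _ (R : Type) (n : nat) := gen_choiceMixin (mps R n).

Section SeriesRing.
Variables (R : comNzRingType) (n : nat).
Implicit Types (f g h : {mps R[n]}) (m : 'X_{1..n}).

Definition mps_zero : {mps R[n]} := MPS (fun=> 0).
Definition mps_one : {mps R[n]} := MPS (fun m => (m == 0%MM)%:R).
Definition mps_opp f : {mps R[n]} := MPS (fun m => - f m).
Definition mps_add f g : {mps R[n]} := MPS (fun m => f m + g m).
Definition mps_mul f g : {mps R[n]} :=
  MPS (fun m => \sum_(k : 'X_{1..n < (mdeg m).+1} | (k <= m)%MM)
                  f k * g (m - k)%MM).

Lemma mps_mulE f g m b : (mdeg m < b)%N ->
  mps_mul f g m = \sum_(k : 'X_{1..n < b} | (k <= m)%MM) f k * g (m - k)%MM.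
Proof.
move=> lt_mb /=.
pose I : subFinType _ := 'X_{1..n < (mdeg m).+1}.
pose J : subFinType _ := 'X_{1..n < b}.
rewrite (big_sub_widen I J (fun k => (k <= m)%MM)
          (fun k => f k * g (m - k)%MM)) /=; last first.
  by move=> x /leq_trans; apply.
apply: eq_bigl => k /=; apply/andP/idP => [[]//|le_km]; split=> //.
rewrite ltnS !mdegE; move/mnm_lepP: le_km => le_km.
by apply: leq_sum => i _; apply: le_km.
Qed.

Lemma mps_mulEr f g m b : (mdeg m < b)%N ->
  mps_mul f g m = \sum_(k : 'X_{1..n < b} | (k <= m)%MM) f (m - k)%MM * g k.
Proof.
move=> lt; rewrite (mps_mulE _ _ lt).
have pr (h : 'X_{1..n}) : (mdeg (m - h)%MM < b)%N.
  exact: leq_ltn_trans (mdegB _ _) _.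
pose F (k : 'X_{1..n < b}) := BMultinom (pr k).
have inv_F (h : 'X_{1..n}): (h <= m)%MM -> (m - (m - h))%MM = h.
  by move=> le_hm; rewrite submBA // addmC addmK.
rewrite (reindex_onto F F) //=; last first.
  by move=> h /inv_F eqh; apply/eqP; rewrite eqE /= eqh.
apply/esym/eq_big => [h /=|h /inv_F -> //]; apply/esym; rewrite lem_subr eqE /=.
by apply/eqP/idP => [<-|/inv_F //]; apply/mnm_lepP=> i; rewrite !mnmBE leq_subr.
Qed.

Lemma mps_addA : associative mps_add.
Proof. by move=> f g h; apply: mpsP => m /=; rewrite addrA. Qed.
Lemma mps_addC : commutative mps_add.
Proof. by move=> f g; apply: mpsP => m /=; rewrite addrC. Qed.
Lemma mps_add0 : left_id mps_zero mps_add.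
Proof. by move=> f; apply: mpsP => m /=; rewrite add0r. Qed.
Lemma mps_addN : left_inverse mps_zero mps_opp mps_add.
Proof. by move=> f; apply: mpsP => m /=; rewrite addNr. Qed.

HB.instance Definition _ := GRing.isZmodule.Build {mps R[n]}
  mps_addA mps_addC mps_add0 mps_addN.

Lemma mps_mulC : commutative mps_mul.
Proof.
move=> f g; apply: mpsP => m.
rewrite (mps_mulE _ _ (ltnSn _)) (mps_mulEr _ _ (ltnSn _)).
by apply: eq_bigr => k _; rewrite mulrC.
Qed.

Lemma mps_mulA : associative mps_mul.
Proof.
move=> p q r; apply: mpsP => mi; pose b := (mdeg mi).+1.
rewrite (mps_mulE _ _ (b := b)) // (mps_mulEr _ _ (b := b)) //.
have h m : (mdeg (mi - m)%MM < b)%N by exact/(leq_ltn_trans (mdegB mi m)).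
pose coef3 mj mk := p mj * (q (mi - mj - mk)%MM * r mk).
transitivity (\sum_(mj : 'X_{1..n < b} | (mj <= mi)%MM)
                \sum_(mk : 'X_{1..n < b} | (mk <= mi - mj)%MM)
                   coef3 mj mk).
  by apply/eq_bigr=> mj _; rewrite (mps_mulEr _ _ (h _)) big_distrr.
pose P (mj : 'X_{1..n < b}) := (mj <= mi)%MM.
rewrite (exchange_big_dep P) // {}/P; last first.
  by move=> mj mk _ /lepm_trans; apply; apply/lem_subr.
apply/eq_bigr=> mk /mnm_lepP le_mk_mi.
transitivity (\sum_(mj : 'X_{1..n < b} | (mj <= mi - mk)%MM) coef3 mj mk).
+ apply/eq_bigl=> m /=.
  apply/idP/idP => [/andP[/mnm_lepP le1 /mnm_lepP le2]|le1].
  * apply/mnm_lepP => i; rewrite mnmBE /leq subnBA // addnC -subnBA //.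
    by rewrite -mnmBE; apply/le2.
  * have le2: (m <= mi)%MM by rewrite (lepm_trans le1) ?lem_subr.
    rewrite le2; apply/mnm_lepP=> i; rewrite mnmBE /leq.
    move/mnm_lepP: le2 => le2; rewrite subnBA // addnC.
    by rewrite -subnBA //; move/mnm_lepP/(_ i): le1; rewrite mnmBE.
rewrite (mps_mulE _ _ (h _)) /coef3 big_distrl.
by apply/eq_bigr=> mj le_mj_miBk; rewrite !mulrA !submDA addmC.
Qed.

Lemma mps_mul1 : left_id mps_one mps_mul.
Proof.
move=> f; apply: mpsP => m /=.
have lt0 : (mdeg (0%MM : 'X_{1..n}) < (mdeg m).+1)%N by rewrite mdeg0.
pose z : 'X_{1..n < (mdeg m).+1} := BMultinom lt0.
rewrite (bigD1 z) /=; last by apply/mnm_lepP => i; rewrite mnmE.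
rewrite subm0 eqxx mul1r big1 ?addr0 // => k /andP[_].
by rewrite eqE /= => /negbTE ->; rewrite mul0r.
Qed.

Lemma mps_mulDl : left_distributive mps_mul mps_add.
Proof.
move=> f g h; apply: mpsP => m /=; rewrite -big_split /=.
by apply: eq_bigr => k _; rewrite mulrDl.
Qed.

Lemma mps_one_neq0 : mps_one != 0.
Proof.
apply/eqP => /(congr1 (fun f : mps R n => f 0%MM)) /=.
by rewrite eqxx => /eqP; rewrite oner_eq0.
Qed.

HB.instance Definition _ := GRing.Zmodule_isComNzRing.Build {mps R[n]}
  mps_mulA mps_mulC mps_mul1 mps_mulDl mps_one_neq0.

Definition mpsC (c : R) : {mps R[n]} := MPS (fun m => c *+ (m == 0%MM)).
Definition mpsX (i : 'I_n) : {mps R[n]} := MPS (fun m => (m == U_(i)%MM)%:R).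

End SeriesRing.

Arguments mpsC {R n} c.
Arguments mpsX {R n} i.

(* f(g_0, ..., g_(n-1)).  When all the g_i have zero constant term, g^a has no
   term of total degree < |a|, so the exponents a with |a| <= |m| are the only
   ones that contribute to the coefficient of m; the formula is meaningful in
   that case only, which is the only one used below. *)
Definition msubst (R : comNzRingType) (n k : nat)
    (g : n.-tuple {mps R[k]}) (f : {mps R[n]}) : {mps R[k]} :=
  MPS (fun m => \sum_(a : 'X_{1..n < (mdeg m).+1})
                  f a * (\prod_(i < n) tnth g i ^+ a i) m).

(* The same substitution in the coefficients of a polynomial in t, an element
   of R[[x_0, ..., x_(n-1)]][t]. *)
Definition tsubst (R : comNzRingType) (n k : nat)
    (g : n.-tuple {mps R[k]}) (G : {poly {mps R[n]}}) : {poly {mps R[k]}} :=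
  map_poly (msubst g) G.

(* A compositional inverse of g, chosen by classical choice (0 if there is
   none). *)
Definition comp_inv (R : comNzRingType) (g : {mps R[1]}) : {mps R[1]} :=
  match pselect (exists h : {mps R[1]},
      [/\ h 0%MM = 0, msubst [tuple h] g = mpsX ord0
        & msubst [tuple g] h = mpsX ord0]) with
  | left ex_h => projT1 (cid ex_h)
  | right _ => 0
  end.

(* A Z-grading of a commutative ring: R is the internal direct sum of its
   homogeneous parts. *)
Record grading (R : comNzRingType) := Grading {
  hpart :> int -> R -> Prop;
  hpart0 : forall d, hpart d 0;
  hpartB : forall d a b, hpart d a -> hpart d b -> hpart d (a - b);
  hpart1 : hpart 0 1;
  hpartM : forall d e a b, hpart d a -> hpart e b -> hpart (d + e) (a * b);
  hpart_sum : forall a, exists (s : seq int) (c : int -> R),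
    (forall d, hpart d (c d)) /\ a = \sum_(d <- s) c d;
  hpart_direct : forall (s : seq int) (c : int -> R), uniq s ->
    (forall d, hpart d (c d)) -> \sum_(d <- s) c d = 0 ->
    forall d, d \in s -> c d = 0
}.

(* f is homogeneous of degree d, each variable having degree -2. *)
Definition mps_homog (R : comNzRingType) (gr : grading R) (n : nat) (d : int)
    (f : {mps R[n]}) : Prop :=
  forall m, gr (d + 2 * (mdeg m)%:Z) (f m).

(* (m, n)-series, as polynomials in t of degree at most m; since |t| = 2, the
   coefficient of t^l has degree -2l. *)
Definition is_series (R : comNzRingType) (gr : grading R) (m n : nat)
    (G : {poly {mps R[n]}}) : Prop :=
  [/\ G`_0 = 1, (size G <= m.+1)%N
    & forall l : nat, mps_homog gr (- (2 * l%:Z)) G`_l].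

(* For G in A[t] with A = R[[x_0, ..., x_(k-1)]], G_t(0) = 1 and deg G <= m, the
   splitting algebra of G is
     A[[r_0, ..., r_(m-1)]] / (coefficients of prod_i (1 + r_i t) - G_t);
   as the r_i are topologically nilpotent, it agrees with the quotient of
   A[r_0, ..., r_(m-1)], and power series can be evaluated at the r_i in it.
   R[[x, r]] is {mps R[k + m]}, the first k variables being the x_j and the last
   m ones the r_i. *)
Definition base (R : comNzRingType) (k m : nat) (f : {mps R[k]}) :
    {mps R[k + m]} :=
  msubst [tuple mpsX (lshift m j) | j < k] f.

Definition tbase (R : comNzRingType) (k m : nat) (G : {poly {mps R[k]}}) :
    {poly {mps R[k + m]}} :=
  tsubst [tuple mpsX (lshift m j) | j < k] G.

Definition root_var (R : comNzRingType) (k m : nat) (i : 'I_m) :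
    {mps R[k + m]} :=
  mpsX (rshift k i).

Definition in_splitting_ideal (R : comNzRingType) (k m : nat)
    (G : {poly {mps R[k]}}) (a : {mps R[k + m]}) : Prop :=
  exists q : 'I_m -> {mps R[k + m]},
    a = \sum_(l < m) q l *
          ((\prod_(i < m) (1 + (root_var R k i)%:P * 'X)) - tbase m G)`_l.+1.

(* T = prod_i H(r_i), where G_t = prod_i (1 + r_i t) in the splitting algebra of
   G.  A = R[[x_0, ..., x_(k-1)]] embeds in the splitting algebra, and a product
   over all roots lies in (the image of) A[t], so T exists and is unique. *)
Definition is_root_prod (R : comNzRingType) (k m : nat) (G : {poly {mps R[k]}})
    (H : {mps R[k + m]} -> {poly {mps R[k + m]}}) (T : {poly {mps R[k]}}) :
    Prop :=
  forall j : nat,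
    in_splitting_ideal G (\prod_(i < m) H (root_var R k i) - tbase m T)`_j.

(* T = Phi_* G for an (m, n)-series G: the r_i(Phi^-1(x_0), ...) are the roots
   of G_t(Phi^-1(x_0), ..., Phi^-1(x_(n-1))). *)
Definition is_transport (R : comNzRingType) (m n : nat) (Phi : {mps R[1]})
    (G T : {poly {mps R[n]}}) : Prop :=
  is_root_prod (m := m)
    (tsubst [tuple msubst [tuple mpsX i] (comp_inv Phi) | i < n] G)
    (fun r => 1 + (msubst [tuple r] Phi)%:P * 'X) T.

Definition iota_of (R : comNzRingType) (Psi : {mps R[1]}) : {mps R[1]} :=
  mpsX ord0 - 2%:R * Psi.

Definition framed_involution (R : comNzRingType) (gr : grading R)
    (Psi : {mps R[1]}) : Prop :=
  [/\ Psi 0%MM = 0, Psi U_(ord0)%MM = 1, mps_homog gr (-2) Psi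
    & msubst [tuple iota_of Psi] (iota_of Psi) = mpsX ord0].

Record formal_ternary_law (R : comNzRingType) (gr : grading R)
    (Psi : {mps R[1]}) (F : {poly {mps R[3]}}) : Prop := FormalTernaryLaw {
  ftl_involution : framed_involution gr Psi;
  ftl_series : is_series gr 4 F;
  ftl_unit :
    let x := mpsX ord0 : {mps R[1]} in
    tsubst [tuple x; 0; 0] F
    = (1 + x%:P * 'X) ^+ 2 * (1 + (iota_of Psi)%:P * 'X) ^+ 2;
  ftl_sym : forall s : 'S_3, tsubst [tuple mpsX (s i) | i < 3] F = F;
  ftl_assoc :
    let x := mpsX 0 : {mps R[5]} in
    let y := mpsX 1 : {mps R[5]} in
    let z := mpsX 2%:R : {mps R[5]} in
    let u := mpsX 3%:R : {mps R[5]} in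
    let v := mpsX 4%:R : {mps R[5]} in
    exists T : {poly {mps R[5]}},
      is_root_prod (m := 4) (tsubst [tuple x; y; z] F)
        (fun r => tsubst [tuple r; base 4 u; base 4 v] F) T /\
      is_root_prod (m := 4) (tsubst [tuple y; z; u] F)
        (fun r => tsubst [tuple base 4 x; r; base 4 v] F) T;
  ftl_parity :
    let x := mpsX 0 : {mps R[3]} in
    let y := mpsX 1 : {mps R[3]} in
    let z := mpsX 2%:R : {mps R[3]} in
    exists Fhat : {poly {mps R[3]}},
      is_transport 4 Psi F Fhat /\
      tsubst [tuple - x; y; z] Fhat = Fhat \Po (- 'X);
  ftl_diag :
    let x := mpsX 0 : {mps R[2]} in
    let y := mpsX 1 : {mps R[2]} in
    exists S P : {mps R[2]},
      tsubst [tuple x; x; y] F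
      = (1 + y%:P * 'X) ^+ 2 * (1 + S%:P * 'X + P%:P * 'X ^+ 2)
}.

(* binom(1/2, k), an element of Z[1/2]: for k > 0 it equals
   (-1)^(k-1) * 2 Cat_(k-1) / 4^k, with Cat_j = 'C(2j, j) / (j+1) the j-th
   Catalan number, see half_binomE below. *)
Definition half_binom (R : unitRingType) (k : nat) : R :=
  if k is j.+1 then
    (-1) ^+ j * (2 * ('C(j.*2, j) %/ j.+1))%:R / 4%:R ^+ k
  else 1.

Lemma catalanE (j : nat) :
  (j.+1 * ('C(j.*2, j) %/ j.+1) = 'C(j.*2, j))%N.
Proof.
rewrite mulnC divnK //; apply/dvdnP; exists ('C(j.*2, j) - 'C(j.*2, j.+1))%N.
have := mul_bin_left j.*2 j; have -> : (j.*2 - j = j)%N by lia.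
by move=> E; rewrite mulnC mulnBr E; nia.
Qed.

Lemma catalanS (j : nat) :
  (j.+2 * ('C(j.+1.*2, j.+1) %/ j.+2)
   = 2 * j.*2.+1 * ('C(j.*2, j) %/ j.+1))%N.
Proof.
have E1 := catalanE j; have E2 := catalanE j.+1.
have := mul_bin_diag j.+1.*2 j; have := mul_bin_down j.*2.+1 j => /=.
have -> : (j.*2.+1 - j = j.+1)%N by lia.
rewrite doubleS /= -doubleS => E3 E4.
apply/eqP; rewrite -(eqn_pmul2l (ltn0Sn j)) E2; apply/eqP.
nia.
Qed.

Lemma half_binomE (k : nat) :
  half_binom rat k = (\prod_(i < k) (2%:R^-1 - i%:R)) / k`!%:R.
Proof.
case: k => [|j]; first by rewrite big_ord0 fact0 divr1.
elim: j => [|j IHj].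
  by rewrite big_ord_recr big_ord0 /half_binom /=; apply/eqP; vm_compute.
rewrite big_ord_recr factS natrM [X in _ / X]mulrC invfM mulrACA -IHj.
rewrite /half_binom.
have /(congr1 (fun n => n%:R : rat)) := catalanS j.
rewrite (_ : j.*2.+1 = 2 * j + 1)%N; last by lia.
rewrite !natrM natrD natrM.
set a := (_ %/ j.+1)%:R; set b := (_ %/ j.+2)%:R => E.
have n0 : j.+2%:R != 0 :> rat by rewrite pnatr_eq0.
have -> : b = 2%:R * (2%:R * j%:R + 1) * a / j.+2%:R.
  by rewrite -[_ * a]E mulrAC mulfV ?mul1r.
have e0 : (4%:R : rat) ^+ j != 0 by rewrite expf_neq0.
rewrite !(exprS _ j.+1) !(exprS _ j) -[X in _ - X]natr1 -[j.+2]addn2 natrD in n0 *.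
by field; rewrite e0 n0.
Qed.

(* sqrt(1 + w) = sum_k binom(1/2, k) w^k, for w with zero constant term: w^k
   has no term of total degree < k. *)
Definition sqrt1 (R : comUnitRingType) (n : nat) (w : {mps R[n]}) :
    {mps R[n]} :=
  MPS (fun m => \sum_(k < (mdeg m).+1) half_binom R k * (w ^+ k) m).

(* D / x_i^2, for a series D divisible by x_i^2. *)
Definition div_sqr (R : comNzRingType) (n : nat) (i : 'I_n) (D : {mps R[n]}) :
    {mps R[n]} :=
  MPS (fun m => D (m + U_(i) + U_(i))%MM).

Section Series.
Variables (R : comUnitRingType) (Psi : {mps R[1]}) (F : {poly {mps R[3]}}).

Let x : {mps R[2]} := mpsX 0.
Let y : {mps R[2]} := mpsX 1.

Definition ftl_S : {mps R[2]} := (tsubst [tuple x; x; y] F)`_1 - 2%:R * y.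

Definition ftl_P : {mps R[2]} :=
  (tsubst [tuple x; x; y] F)`_2 - 2%:R * y * ftl_S - y ^+ 2.

Definition ftl_D : {mps R[2]} := ftl_S ^+ 2 - 4%:R * ftl_P.

Definition ftl_sqrtD : {mps R[2]} :=
  4%:R * x * sqrt1 (mpsC (16%:R^-1) * div_sqr 0 ftl_D - 1).

Definition ftl_B : {mps R[2]} := mpsC (2%:R^-1) * (ftl_S - ftl_sqrtD).

Definition ftl_f : {mps R[2]} :=
  msubst [tuple msubst [tuple x] (iota_of Psi);
                msubst [tuple y] (iota_of Psi)] ftl_B.

Definition ftl_two : {mps R[1]} := msubst [tuple mpsX ord0; 0] ftl_f.
Definition ftl_half : {mps R[1]} := comp_inv ftl_two.

Definition ftl_mu : {mps R[2]} :=
  msubst [tuple msubst [tuple x] ftl_half; y] ftl_f.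

End Series.

(* One-dimensional commutative formal group law over a graded ring, with
   coordinate of degree -2. *)
Record formal_group_law (R : comNzRingType) (gr : grading R)
    (mu : {mps R[2]}) : Prop := FormalGroupLaw {
  fgl_homog : mps_homog gr (-2) mu;
  fgl_unitl : msubst [tuple 0; mpsX ord0] mu = mpsX ord0 :> {mps R[1]};
  fgl_unitr : msubst [tuple mpsX ord0; 0] mu = mpsX ord0 :> {mps R[1]};
  fgl_comm : msubst [tuple mpsX 1; mpsX 0] mu = mu;
  fgl_assoc :
    let x := mpsX 0 : {mps R[3]} in
    let y := mpsX 1 : {mps R[3]} in
    let z := mpsX 2%:R : {mps R[3]} in
    msubst [tuple msubst [tuple x; y] mu; z] mu
    = msubst [tuple x; msubst [tuple y; z] mu] mu
}.

(* Main.v *)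
(* Let [B] and [B'] be the two roots of [1 + S t + P t^2], that is, the roots of
   [F_t(x, x, y)] other than [y].  Associativity at [(x, 0, 0, u, v)] gives
   [F_t(iota x, u, v)^2 = F_t(x, iota u, v)^2], so [S], [P] and [D] are
   invariant under [x -> iota x].  As [D] vanishes at [x = 0], it is divisible by [x^2],
   hence is a square, [B] and [B'] are power series and
   [B'(x, y) = B(iota x, y)].
   With the parity axiom, [f(x, y) = iota (B(x, y))] and
   [f(u, f(x, y)) = B'(u, B(x, y))].
   Associativities for which all the roots are explicit show that the product of
   the four factors [1 + B^{+-}(u, B^{+-}(x, y)) t] is symmetric in [x] and [u].
   Roots with different linear parts differ by a regular element, so equal
   products have equal roots, and the translations [f(x, -)] commute.  Hence
   [mu(x, mu(y, z)) = mu(y, mu(x, z))]; together with [mu(x, 0) = x] this gives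
   commutativity, then associativity. *)
From HB Require Import structures.
Require Import Defs.
From mathcomp Require Import all_boot all_order all_fingroup all_algebra.
From mathcomp Require Import ring zify.
From mathcomp Require Import boolp mpoly.

Set Implicit Arguments.
Unset Strict Implicit.
Unset Printing Implicit Defensive.

Import GRing.Theory.
Local Open Scope ring_scope.


(** Two obstacles shape the proof: the roots of F_t live a priori only in a splitting algebra, and R
    may have zero divisors. To avoid the splitting algebras, associativity and parity are evaluated
    only at points where all four roots are known power series. Such points are F_t(x, 0, 0), by the
    unit axiom, and F_t(x, x, y), by the diagonal axiom; there the splitting ideal specializes to 0.
    To compare roots without a domain, one uses linear parts: B begins with -2x - y and B' with 2x -
    y. A series with zero constant term and a unit coefficient at one variable is regular, and the
    differences of roots to be cancelled all have a coefficient 4 or -4 at some variable. Polynomial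
    factors 1 + a t are cancelled for a simpler reason: their constant term is 1. The link between
    parity and iota is the identity Psi(iota x) = - Psi(x): in the coordinate Psi the involution is
    the sign. *)

(** * Coefficients, monomials and order of power series *)

Section Coefficients.
Variables (R : comNzRingType) (n : nat).
Implicit Types (f g : {mps R[n]}) (a m : 'X_{1..n}).

Definition mon a : {mps R[n]} := MPS (fun m => (m == a)%:R).

Lemma scoef_mon a m : mon a m = (m == a)%:R. Proof. by []. Qed.
Lemma scoef0 m : (0 : {mps R[n]}) m = 0. Proof. by []. Qed.
Lemma scoef1 m : (1 : {mps R[n]}) m = (m == 0%MM)%:R. Proof. by []. Qed.
Lemma scoefN f m : (- f) m = - f m. Proof. by []. Qed.
Lemma scoefD f g m : (f + g) m = f m + g m. Proof. by []. Qed.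
Lemma scoefB f g m : (f - g) m = f m - g m. Proof. by []. Qed.
Lemma scoefC (c : R) m : (mpsC c : {mps R[n]}) m = c *+ (m == 0%MM).
Proof. by []. Qed.
Lemma scoefX i m : (mpsX i : {mps R[n]}) m = (m == U_(i)%MM)%:R.
Proof. by []. Qed.

Lemma scoefM f g m : (f * g) m =
  \sum_(k : 'X_{1..n < (mdeg m).+1} | (k <= m)%MM) f k * g (m - k)%MM.
Proof. by []. Qed.

Lemma scoef_sum (I : Type) (r : seq I) (P : pred I) (F : I -> {mps R[n]}) m :
  (\sum_(i <- r | P i) F i) m = \sum_(i <- r | P i) F i m.
Proof. by elim/big_rec2: _ => // i a b _ <-. Qed.

Lemma scoef_monM a f m :
  (mon a * f) m = if (a <= m)%MM then f (m - a)%MM else 0.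
Proof.
rewrite scoefM; case: ifPn => [le_am|nle_am].
  have lt_a : (mdeg a < (mdeg m).+1)%N.
    by rewrite ltnS !mdegE leq_sum // => i _; apply/mnm_lepP.
  rewrite (bigD1 (BMultinom lt_a)) //= eqxx mul1r big1 ?addr0 // => k /andP[_].
  by rewrite eqE /= => /negbTE ->; rewrite mul0r.
rewrite big1 // => k le_km; rewrite scoef_mon; case: eqP => [E|]; last first.
  by rewrite mul0r.
by rewrite -E le_km in nle_am.
Qed.

Lemma scoefCM (c : R) f m : (mpsC c * f) m = c * f m.
Proof.
have lt0 : (mdeg (0%MM : 'X_{1..n}) < (mdeg m).+1)%N.
  by rewrite mdeg0.
rewrite scoefM (bigD1 (BMultinom lt0)) /=; last first.
  by apply/mnm_lepP => i; rewrite mnm0E.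
rewrite subm0 eqxx big1 ?addr0 // => k /andP[_].
by rewrite eqE /= => /negbTE ->; rewrite mul0r.
Qed.

Lemma mon0 : mon 0%MM = 1. Proof. exact: mpsP. Qed.
Lemma monU i : mon U_(i)%MM = mpsX i. Proof. exact: mpsP. Qed.

Lemma monD a b : mon (a + b)%MM = mon a * mon b.
Proof.
apply: mpsP => m; rewrite scoef_monM scoef_mon scoef_mon.
case: ifPn => [le_am|].
  congr (nat_of_bool _)%:R; apply/eqP/eqP => [->|<-].
    by rewrite addmC addmK.
  by rewrite addmC submK.
by case: eqP => // ->; rewrite lem_addr.
Qed.

Lemma mon_prod a : mon a = \prod_(i < n) mpsX i ^+ a i.
Proof.
have monMn b k : mon (b *+ k)%MM = mon b ^+ k.
  elim: k => [|k IH]; first by rewrite mulm0n mon0.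
  by rewrite mulmS monD IH exprS.
rewrite {1}[a]multinomUE_id (big_morph _ monD mon0).
by apply: eq_bigr => i _; rewrite monMn monU.
Qed.

Definition ord_ge N f := forall m, (mdeg m < N)%N -> f m = 0.

Lemma ord_ge0 f : ord_ge 0 f. Proof. by []. Qed.

Lemma ord_ge1 f : f 0%MM = 0 -> ord_ge 1 f.
Proof. by move=> f0 m; rewrite ltnS leqn0 mdeg_eq0 => /eqP ->. Qed.

Lemma ord_geM N M f g : ord_ge N f -> ord_ge M g -> ord_ge (N + M) (f * g).
Proof.
move=> oN oM m lt_m; rewrite scoefM big1 // => k le_km.
have [lt_k|le_k] := ltnP (mdeg k) N; first by rewrite oN ?mul0r.
have := congr1 mdeg (submK le_km); rewrite mdegD => E.
by rewrite oM ?mulr0 //; lia.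
Qed.

Lemma ord_geX f k : f 0%MM = 0 -> ord_ge k (f ^+ k).
Proof.
move=> f0; elim: k => // k IH; rewrite exprS -add1n.
by apply: ord_geM => //; apply: ord_ge1.
Qed.

Lemma ord_ge_prod k (g : 'I_k -> {mps R[n]}) (a : 'X_{1..k}) :
  (forall i, g i 0%MM = 0) -> ord_ge (mdeg a) (\prod_(i < k) g i ^+ a i).
Proof.
move=> g0; rewrite mdegE; elim/big_rec2: _ => [|i N f _ IH]; first by [].
by apply: ord_geM => //; apply: ord_geX.
Qed.

Definition mps_trunc N f : {mps R[n]} :=
  \sum_(a : 'X_{1..n < N}) mpsC (f a) * mon a.

Lemma mps_truncP N f : ord_ge N (f - mps_trunc N f).
Proof.
move=> m lt_m; rewrite scoefB scoef_sum (bigD1 (BMultinom lt_m)) //.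
rewrite scoefCM scoef_mon eqxx mulr1 big1 => [/=|k].
  by rewrite addr0 subrr.
by rewrite scoefCM scoef_mon eqE /= eq_sym => /negbTE ->; rewrite mulr0.
Qed.

End Coefficients.

Arguments mon {R n} a.

(** Modulo terms of order at least [N], a series is a finite sum of scaled monomials, and maps that
    preserve the order do not see the rest. The main substitution identities are reduced to
    monomials through this. *)
Lemma mps_additive_ext (R : comNzRingType) (n k : nat)
    (phi psi : {mps R[n]} -> {mps R[k]}) :
  {morph phi : f g / f + g} -> {morph psi : f g / f + g} ->
  (forall N f, ord_ge N f -> ord_ge N (phi f)) ->
  (forall N f, ord_ge N f -> ord_ge N (psi f)) ->
  (forall c a, phi (mpsC c * mon a) = psi (mpsC c * mon a)) -> phi =1 psi.
Proof.
move=> phiD psiD phiO psiO eq_mon f.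
have add0 (h : {mps R[n]} -> {mps R[k]}) :
    {morph h : f g / f + g} -> h 0 = 0.
  by move=> hD; apply: (@addrI _ (h 0)); rewrite -hD !addr0.
apply: mpsP => m; pose t := mps_trunc (mdeg m).+1 f.
have E : phi t = psi t.
  rewrite (big_morph phi phiD (add0 _ phiD)) (big_morph psi psiD (add0 _ psiD)).
  by apply: eq_bigr => a _.
have O := @mps_truncP _ _ (mdeg m).+1 f; rewrite -[f](subrK t) phiD psiD E.
by rewrite !scoefD (phiO _ _ O) ?(psiO _ _ O).
Qed.

(** * Substitution as a ring morphism *)

Section Substitution.
Variables (R : comNzRingType) (n k : nat) (g : n.-tuple {mps R[k]}).
Implicit Types (f : {mps R[n]}).

Definition topnil := forall i, tnth g i 0%MM = 0.

Lemma scoef_msubst f m : msubst g f m = \sum_(a : 'X_{1..n < (mdeg m).+1})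
  f a * (\prod_(i < n) tnth g i ^+ a i) m.
Proof. by []. Qed.

Lemma msubstD : {morph msubst g : f1 f2 / f1 + f2}.
Proof.
move=> f1 f2; apply: mpsP => m /=; rewrite -big_split /=.
by apply: eq_bigr => a _; rewrite mulrDl.
Qed.

Lemma msubst_ord N f : ord_ge N f -> ord_ge N (msubst g f).
Proof.
move=> oN m lt_m /=; rewrite big1 // => a _; rewrite oN ?mul0r //.
by case: a => a /= lt_a; lia.
Qed.

Hypothesis g0 : topnil.

Lemma msubst_CM c f : msubst g (mpsC c * f) = mpsC c * msubst g f.
Proof.
apply: mpsP => m; rewrite scoefCM !scoef_msubst mulr_sumr.
by apply: eq_bigr => a _; rewrite scoefCM mulrA.
Qed.

Lemma msubst_mon a : msubst g (mon a) = \prod_(i < n) tnth g i ^+ a i.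
Proof.
apply: mpsP => m; rewrite scoef_msubst.
have [lt_a|le_a] := ltnP (mdeg a) (mdeg m).+1.
  rewrite (bigD1 (BMultinom lt_a)) //= eqxx mul1r.
  rewrite [X in _ + X]big1 ?addr0 // => b.
  by rewrite eqE /= => /negbTE ->; rewrite mul0r.
rewrite (ord_ge_prod (a := a) g0) // big1 // => -[b lt_b] _ /=.
by case: eqP => [E|]; rewrite ?mul0r //; move: lt_b; rewrite E; lia.
Qed.

(** Multiplicativity on monomials extends by continuity in one factor, then in the other. *)
Lemma msubstM : {morph msubst g : f1 f2 / f1 * f2}.
Proof.
have DM c a f2 : msubst g (mpsC c * mon a * f2)
    = msubst g (mpsC c * mon a) * msubst g f2.
  pose phi f := msubst g (mpsC c * mon a * f).
  pose psi f := msubst g (mpsC c * mon a) * msubst g f.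
  apply: (@mps_additive_ext _ _ _ phi psi).
  - by move=> x y; rewrite /phi mulrDr msubstD.
  - by move=> x y; rewrite /psi msubstD mulrDr.
  - move=> N f oN; apply: msubst_ord; rewrite -[N]add0n.
    by apply: ord_geM => //; apply: ord_ge0.
  - move=> N f oN; rewrite -[N]add0n; apply: ord_geM; first exact: ord_ge0.
    exact: msubst_ord.
  move=> d b; rewrite /phi /psi mulrACA -monD -mulrA !msubst_CM !msubst_mon.
  rewrite mulrACA -!mulrA -big_split /=; congr (_ * (_ * _)).
  by apply: eq_bigr => i _; rewrite mnmDE exprD.
move=> f1 f2; pose phi f := msubst g (f * f2).
pose psi f := msubst g f * msubst g f2.
apply: (@mps_additive_ext _ _ _ phi psi) => //.
- by move=> x y; rewrite /phi mulrDl msubstD.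
- by move=> x y; rewrite /psi msubstD mulrDl.
- move=> N f oN; apply: msubst_ord; rewrite -[N]addn0.
  by apply: ord_geM => //; apply: ord_ge0.
- move=> N f oN; rewrite -[N]addn0; apply: ord_geM; last exact: ord_ge0.
  exact: msubst_ord.
- by move=> c a; apply: DM.
Qed.

Lemma msubst1 : msubst g 1 = 1.
Proof.
by rewrite -mon0 msubst_mon big1 // => i _; rewrite mnm0E.
Qed.

(** In general [msubst g] is a morphism only when [g] is topologically nilpotent; carrying that
    proof as an argument lets the morphism structures be attached to it. *)
Definition msubst_morph of topnil := msubst g.
Let h := msubst_morph g0.

Lemma msubst_is_zmod : zmod_morphism h.
Proof.
have h0 : h 0 = 0 by apply: (@addrI _ (h 0)); rewrite -msubstD !addr0.
move=> x y; rewrite /h /msubst_morph msubstD; congr (_ + _).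
by apply: (@addrI _ (h y)); rewrite -msubstD !subrr.
Qed.

Lemma msubst_is_monoid : monoid_morphism h.
Proof. by split; [apply: msubst1|apply: msubstM]. Qed.

HB.instance Definition _ :=
  GRing.isZmodMorphism.Build _ _ (msubst_morph g0) msubst_is_zmod.
HB.instance Definition _ :=
  GRing.isMonoidMorphism.Build _ _ (msubst_morph g0) msubst_is_monoid.

Lemma msubst0 : msubst g 0 = 0. Proof. exact: (rmorph0 h). Qed.
Lemma msubstN f : msubst g (- f) = - msubst g f.
Proof. exact: (rmorphN h). Qed.
Lemma msubstB f1 f2 : msubst g (f1 - f2) = msubst g f1 - msubst g f2.
Proof. exact: (rmorphB h). Qed.
Lemma msubstXn f j : msubst g (f ^+ j) = msubst g f ^+ j.
Proof. exact: (rmorphXn h). Qed.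
Lemma msubst_nat j : msubst g j%:R = j%:R.
Proof. exact: (rmorph_nat h). Qed.

Lemma msubst_sum (I : Type) (r : seq I) (P : pred I) F :
  msubst g (\sum_(i <- r | P i) F i) = \sum_(i <- r | P i) msubst g (F i).
Proof. exact: (rmorph_sum h). Qed.
Lemma msubst_prod (I : Type) (r : seq I) (P : pred I) F :
  msubst g (\prod_(i <- r | P i) F i) = \prod_(i <- r | P i) msubst g (F i).
Proof. exact: (rmorph_prod h). Qed.

Lemma msubst_C c : msubst g (mpsC c) = mpsC c.
Proof. by rewrite -[mpsC c]mulr1 msubst_CM msubst1 mulr1. Qed.

Lemma msubst_X i : msubst g (mpsX i) = tnth g i.
Proof.
rewrite -monU msubst_mon (bigD1 i) //= big1 => [|j ne_ji].
  by rewrite mulr1 mnm1E eqxx.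
by rewrite mnm1E eq_sym (negbTE ne_ji).
Qed.

Lemma scoef0_msubst f : msubst g f 0%MM = f 0%MM.
Proof.
rewrite -{1}[f](subrK (mpsC (f 0%MM))) msubstD msubst_C scoefD scoefC eqxx.
rewrite (msubst_ord (N := 1)) ?add0r ?mdeg0 //.
by apply: ord_ge1; rewrite scoefB scoefC eqxx subrr.
Qed.

End Substitution.

Lemma msubst_comp (R : comNzRingType) (n k l : nat) (g : n.-tuple {mps R[k]})
    (h : k.-tuple {mps R[l]}) (f : {mps R[n]}) : topnil g -> topnil h ->
  msubst h (msubst g f) = msubst [tuple of map (msubst h) g] f.
Proof.
move=> g0 h0; have gh0 : topnil [tuple of map (msubst h) g].
  by move=> i; rewrite tnth_map scoef0_msubst.
apply: (@mps_additive_ext _ _ _ (msubst h \o msubst g)).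
- by move=> x y /=; rewrite !msubstD.
- by move=> x y; rewrite msubstD.
- by move=> N x oN; do 2!apply: msubst_ord.
- by move=> N x oN; apply: msubst_ord.
move=> c a /=; rewrite !msubst_CM // !msubst_mon // msubst_prod //.
by congr (_ * _); apply: eq_bigr => i _; rewrite msubstXn // tnth_map.
Qed.

Lemma msubst_id (R : comNzRingType) (n : nat) (f : {mps R[n]}) :
  msubst [tuple mpsX i | i < n] f = f.
Proof.
have g0 : topnil [tuple (mpsX i : {mps R[n]}) | i < n].
  by move=> i; rewrite tnth_mktuple scoefX eq_sym mnm1_eq0.
apply: (@mps_additive_ext _ _ _ _ id) => //; first exact: msubstD.
- by move=> N x; apply: msubst_ord.
move=> c a; rewrite msubst_CM // msubst_mon // mon_prod.
by congr (_ * _); apply: eq_bigr => i _; rewrite tnth_mktuple.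
Qed.

(** * Constant terms, explicit tuples and linear parts *)

Section ConstantTerms.
Variables (R : comNzRingType) (n : nat).
Implicit Types f g : {mps R[n]}.

Lemma nil0 : (0 : {mps R[n]}) 0%MM = 0. Proof. by []. Qed.
Lemma nilX i : (mpsX i : {mps R[n]}) 0%MM = 0.
Proof. by rewrite scoefX eq_sym mnm1_eq0. Qed.
Lemma nilN f : f 0%MM = 0 -> (- f) 0%MM = 0.
Proof. by rewrite scoefN => ->; rewrite oppr0. Qed.
Lemma nilD f g : f 0%MM = 0 -> g 0%MM = 0 -> (f + g) 0%MM = 0.
Proof. by rewrite scoefD => -> ->; rewrite addr0. Qed.

Lemma scoefM0 f g : (f * g) 0%MM = f 0%MM * g 0%MM.
Proof.
rewrite -{1}[f](subrK (mpsC (f 0%MM))) mulrDl scoefD scoefCM.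
have o1 : ord_ge 1 (f - mpsC (f 0%MM)).
  by apply: ord_ge1; rewrite scoefB scoefC eqxx subrr.
by rewrite (ord_geM o1 (@ord_ge0 _ _ g)) ?mdeg0 ?add0r.
Qed.

Lemma nilMl f g : f 0%MM = 0 -> (f * g) 0%MM = 0.
Proof. by rewrite scoefM0 => ->; rewrite mul0r. Qed.
Lemma nilMr f g : g 0%MM = 0 -> (f * g) 0%MM = 0.
Proof. by rewrite scoefM0 => ->; rewrite mulr0. Qed.

Lemma scoefMU f g i :
  (f * g) U_(i)%MM = f 0%MM * g U_(i)%MM + f U_(i)%MM * g 0%MM.
Proof.
pose cf : {mps R[n]} := mpsC (f 0%MM); pose cg : {mps R[n]} := mpsC (g 0%MM).
have of1 : ord_ge 1 (f - cf).
  by apply: ord_ge1; rewrite scoefB scoefC eqxx subrr.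
have og1 : ord_ge 1 (g - cg).
  by apply: ord_ge1; rewrite scoefB scoefC eqxx subrr.
have -> : f * g = (f - cf) * (g - cg) + cf * g + cg * f - cf * cg by ring.
rewrite scoefB !scoefD !scoefCM (ord_geM of1 og1) ?mdeg1 // scoefC mnm1_eq0.
by rewrite mulr0n mulr0 subr0 add0r [f _ * _]mulrC addrC [_ * f _]mulrC addrC.
Qed.

Lemma scoefMn f k m : (f *+ k) m = f m *+ k.
Proof. by elim: k => // k IH; rewrite !mulrS scoefD IH. Qed.

Lemma scoef_natM k f m : (k%:R * f) m = k%:R * f m.
Proof. by rewrite !mulr_natl scoefMn. Qed.

Lemma mpsC_morph : {morph @mpsC R n : a b / a * b}.
Proof.
by move=> a b; apply: mpsP => m; rewrite scoefCM !scoefC mulrnAr.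
Qed.

Lemma mpsC1 : mpsC 1 = 1 :> {mps R[n]}.
Proof. exact: mpsP. Qed.

Lemma mpsC_nat k : mpsC k%:R = k%:R :> {mps R[n]}.
Proof.
elim: k => [|k IH]; first by apply: mpsP => m; rewrite scoefC mul0rn.
rewrite [in RHS]mulrS -IH; apply: mpsP => m.
by rewrite scoefD !scoefC mulrS mulrnDl.
Qed.

End ConstantTerms.

Section ExplicitTuples.
Variables (R : comNzRingType) (k l : nat) (h : k.-tuple {mps R[l]}).
Implicit Types a b c d e : {mps R[k]}.

Lemma topnil1 a : a 0%MM = 0 -> topnil [tuple a].
Proof. by move=> ? [[|//] ?]; rewrite (tnth_nth 0). Qed.
Lemma topnil2 a b : a 0%MM = 0 -> b 0%MM = 0 -> topnil [tuple a; b].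
Proof. by move=> ? ? [[|[|//]] ?]; rewrite (tnth_nth 0). Qed.
Lemma topnil3 a b c :
  a 0%MM = 0 -> b 0%MM = 0 -> c 0%MM = 0 -> topnil [tuple a; b; c].
Proof. by move=> ? ? ? [[|[|[|//]]] ?]; rewrite (tnth_nth 0). Qed.
Lemma topnil4 a b c d : a 0%MM = 0 -> b 0%MM = 0 -> c 0%MM = 0 -> d 0%MM = 0 ->
  topnil [tuple a; b; c; d].
Proof. by move=> ? ? ? ? [[|[|[|[|//]]]] ?]; rewrite (tnth_nth 0). Qed.
Lemma topnil5 a b c d e : a 0%MM = 0 -> b 0%MM = 0 -> c 0%MM = 0 ->
  d 0%MM = 0 -> e 0%MM = 0 -> topnil [tuple a; b; c; d; e].
Proof. by move=> ? ? ? ? ? [[|[|[|[|[|//]]]]] ?]; rewrite (tnth_nth 0). Qed.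

Hypothesis h0 : topnil h.

Lemma msubst_comp1 (f : {mps R[1]}) a : a 0%MM = 0 ->
  msubst h (msubst [tuple a] f) = msubst [tuple msubst h a] f.
Proof.
move=> a0; rewrite msubst_comp //; last exact: topnil1.
by congr (msubst _ f); apply: val_inj.
Qed.

Lemma msubst_comp2 (f : {mps R[2]}) a b : a 0%MM = 0 -> b 0%MM = 0 ->
  msubst h (msubst [tuple a; b] f) = msubst [tuple msubst h a; msubst h b] f.
Proof.
move=> a0 b0; rewrite msubst_comp //; last exact: topnil2.
by congr (msubst _ f); apply: val_inj.
Qed.

Lemma msubst_comp3 (f : {mps R[3]}) a b c :
  a 0%MM = 0 -> b 0%MM = 0 -> c 0%MM = 0 ->
  msubst h (msubst [tuple a; b; c] f)
  = msubst [tuple msubst h a; msubst h b; msubst h c] f.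
Proof.
move=> a0 b0 c0; rewrite msubst_comp //; last exact: topnil3.
by congr (msubst _ f); apply: val_inj.
Qed.

Lemma nil_msubst (f : {mps R[k]}) : f 0%MM = 0 -> (msubst h f) 0%MM = 0.
Proof. by rewrite scoef0_msubst. Qed.

End ExplicitTuples.

Ltac nil := repeat first
  [ assumption | apply: nilX | apply: nil0 | apply: nilN | apply: nilD
  | apply: nil_msubst | apply: topnil1 | apply: topnil2 | apply: topnil3
  | apply: topnil4 | apply: topnil5
  | by apply: nilMl; nil | by apply: nilMr; nil ].

Section SubstVariables.
Variables (R : comNzRingType) (k : nat).
Implicit Types a b c : {mps R[k]}.

Lemma msubst_var1 a i : a 0%MM = 0 -> msubst [tuple a] (mpsX i) = a.
Proof. by move=> a0; rewrite msubst_X ?ord1 //; nil. Qed.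

Lemma msubst_var20 a b : a 0%MM = 0 -> b 0%MM = 0 ->
  msubst [tuple a; b] (mpsX 0) = a.
Proof. by move=> a0 b0; rewrite msubst_X //; nil. Qed.
Lemma msubst_var21 a b : a 0%MM = 0 -> b 0%MM = 0 ->
  msubst [tuple a; b] (mpsX 1) = b.
Proof. by move=> a0 b0; rewrite msubst_X //; nil. Qed.

Lemma msubst_var30 a b c : a 0%MM = 0 -> b 0%MM = 0 -> c 0%MM = 0 ->
  msubst [tuple a; b; c] (mpsX 0) = a.
Proof. by move=> a0 b0 c0; rewrite msubst_X //; nil. Qed.
Lemma msubst_var31 a b c : a 0%MM = 0 -> b 0%MM = 0 -> c 0%MM = 0 ->
  msubst [tuple a; b; c] (mpsX 1) = b.
Proof. by move=> a0 b0 c0; rewrite msubst_X //; nil. Qed.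
Lemma msubst_var32 a b c : a 0%MM = 0 -> b 0%MM = 0 -> c 0%MM = 0 ->
  msubst [tuple a; b; c] (mpsX 2%:R) = c.
Proof. by move=> a0 b0 c0; rewrite msubst_X //; nil. Qed.

Lemma msubst_id1 (f : {mps R[1]}) : msubst [tuple mpsX ord0] f = f.
Proof.
rewrite -[RHS]msubst_id; congr (msubst _ f); apply: eq_from_tnth => i.
by rewrite tnth_mktuple (ord1 i).
Qed.

Lemma msubst_id2 (f : {mps R[2]}) : msubst [tuple mpsX 0; mpsX 1] f = f.
Proof.
rewrite -[RHS]msubst_id; congr (msubst _ f); apply: eq_from_tnth => i.
rewrite tnth_mktuple; case: i => [[|[|//]] lt]; rewrite (tnth_nth 0) /=.
  by congr mpsX; apply: val_inj.
by congr mpsX; apply: val_inj.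
Qed.

End SubstVariables.

(** Chain rule at the origin: [f] minus its constant and linear parts has order 2, and substitution
    preserves the order. *)
Lemma scoefU_msubst (R : comNzRingType) (n k : nat) (g : n.-tuple {mps R[k]})
    (f : {mps R[n]}) j : topnil g ->
  (msubst g f) U_(j)%MM = \sum_(i < n) f U_(i)%MM * (tnth g i) U_(j)%MM.
Proof.
move=> g0; pose L : {mps R[n]} := \sum_(i < n) mpsC (f U_(i)%MM) * mpsX i.
have o2 : ord_ge 2 (f - (mpsC (f 0%MM) + L)).
  move=> m; rewrite ltnS leq_eqVlt ltnS leqn0 => /orP[]; last first.
    rewrite mdeg_eq0 => /eqP ->; rewrite scoefB scoefD scoefC eqxx scoef_sum.
    rewrite big1 ?addr0 ?subrr // => i _.
    by rewrite scoefCM nilX mulr0.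
  case/mdeg1P => i /eqP ->; rewrite scoefB scoefD scoefC mnm1_eq0 add0r.
  rewrite scoef_sum (bigD1 i) // big1 => [|i' ne]; rewrite scoefCM scoefX.
    by rewrite eqxx mulr1 /= addr0 subrr.
  case: eqP => [/mnmP/(_ i)|]; rewrite ?mulr0 //.
  by rewrite !mnm1E eqxx (negbTE ne).
have := msubst_ord g o2 => /(_ U_(j)%MM); rewrite mdeg1 => /(_ isT).
rewrite msubstB // msubstD msubst_C // scoefB => /eqP; rewrite subr_eq0.
move=> /eqP ->; rewrite scoefD scoefC mnm1_eq0 add0r msubst_sum // scoef_sum.
 apply: eq_bigr => i _.
by rewrite msubst_CM scoefCM msubst_X.
Qed.

Section LinearParts.
Variables (R : comNzRingType) (k : nat).
Implicit Types a b c : {mps R[k]}.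

Lemma scoefU_msubst1 (f : {mps R[1]}) a j : a 0%MM = 0 ->
  (msubst [tuple a] f) U_(j)%MM = f U_(ord0)%MM * a U_(j)%MM.
Proof. by move=> a0; rewrite scoefU_msubst ?big_ord1 //; nil. Qed.

Lemma scoefU_msubst2 (f : {mps R[2]}) a b j : a 0%MM = 0 -> b 0%MM = 0 ->
  (msubst [tuple a; b] f) U_(j)%MM
  = f U_(0%R)%MM * a U_(j)%MM + f U_(1%R)%MM * b U_(j)%MM.
Proof.
move=> a0 b0; rewrite scoefU_msubst; last by nil.
by rewrite 2!big_ord_recl big_ord0 addr0; congr (_ + f U_(_)%MM * _);
  apply: val_inj.
Qed.

End LinearParts.

(** * Division by a variable, and regular series *)

Section Shift.
Variables (R : comNzRingType) (n : nat) (i : 'I_n).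
Implicit Types f g : {mps R[n]}.

(* The quotient of [f] by [mpsX i] when [mpsX i] divides [f]. *)
Definition mshift f : {mps R[n]} := MPS (fun m => f (m + U_(i))%MM).

Lemma scoef_shift f m : mshift f m = f (m + U_(i))%MM. Proof. by []. Qed.

Lemma mshiftK f : mshift (mpsX i * f) = f.
Proof.
apply: mpsP => m; rewrite scoef_shift -monU scoef_monM addmK.
by rewrite addmC lem_addr.
Qed.

Lemma mpsX_inj f g : mpsX i * f = mpsX i * g -> f = g.
Proof. by move/(congr1 mshift); rewrite !mshiftK. Qed.

Lemma mpsX_mshift f : (forall m : 'X_{1..n}, m i = 0%N -> f m = 0) ->
  f = mpsX i * mshift f.
Proof.
move=> f0; apply: mpsP => m; rewrite -monU scoef_monM.
case: ifPn => [le_m|nle]; first by rewrite /= submK.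
apply: f0; apply/eqP; rewrite -leqn0 leqNgt; apply: contra nle => lt_m.
by apply/mnm_lepP => j; rewrite mnm1E; case: eqP => // <-.
Qed.

End Shift.

Lemma mpsX0_dvd (R : comNzRingType) (f : {mps R[2]}) :
  msubst [tuple 0; mpsX 1] f = 0 :> {mps R[2]} -> f = mpsX 0 * mshift 0 f.
Proof.
move=> f0; apply: mpsX_mshift => m m0.
have t0 : topnil [tuple (0 : {mps R[2]}); mpsX 1] by nil.
(* Setting the first variable to 0 keeps exactly the monomials free of it; [psi] expresses this on
   coefficients. *)
pose psi (h : {mps R[2]}) : {mps R[2]} := MPS (fun m => h m *+ (m 0 == 0%N)).
have E : msubst [tuple 0; mpsX 1] f = psi f.
  apply: (@mps_additive_ext _ _ _ _ psi).
  - exact: msubstD.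
  - by move=> x y; apply: mpsP => m1 /=; rewrite mulrnDl.
  - by move=> N g; apply: msubst_ord.
  - by move=> N g oN m1 lt /=; rewrite oN ?mul0rn.
  move=> c a; rewrite msubst_CM // msubst_mon //.
  have -> : \prod_(i < 2) tnth [tuple 0; mpsX 1] i ^+ a i
      = mon a *+ (a 0 == 0%N) :> {mps R[2]}.
    rewrite mon_prod !big_ord_recl !big_ord0 !mulr1.
    rewrite -[tnth _ ord0]/(0 : {mps R[2]}) -[tnth _ _]/(mpsX 1 : {mps R[2]}).
    rewrite -[a ord0]/(a 0); have [->|a0] := eqVneq (a 0) 0%N; last first.
      by rewrite expr0n (negbTE a0) mul0r mulr0n.
    by rewrite !expr0 !mul1r mulr1n; congr (mpsX _ ^+ _); apply: val_inj.
  have psiE g : psi g = MPS (fun m => g m *+ (m 0 == 0%N)) by [].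
  apply: mpsP => m1; rewrite psiE scoefCM scoefMn.
  rewrite -[RHS]/((mpsC c * mon a) m1 *+ _) scoefCM mulrnAr scoef_mon.
  by case: eqP => [->|_] //; rewrite mulr0 !mul0rn.
have : psi f m = 0 by rewrite -E f0.
by rewrite /psi /= m0 eqxx.
Qed.

(* [W m = 2|m| - m_i] is a weight for which, in [f * g], the linear term at [i]
   of [f] is the unique lowest one. *)
Lemma mps_regular (R : comUnitRingType) (n : nat) (f g : {mps R[n]}) i :
  f 0%MM = 0 -> f U_(i)%MM \is a GRing.unit -> f * g = 0 -> g = 0.
Proof.
move=> f0 fu fg0; apply: mpsP => m; rewrite scoef0.
pose W (m : 'X_{1..n}) := (2 * mdeg m - m i)%N.
have le_deg (a : 'X_{1..n}) : (a i <= mdeg a)%N.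
  by rewrite mdegE (bigD1 i) //= leq_addr.
have [N leN] : exists N, (W m < N)%N by exists (W m).+1.
elim: N => // N IH in m leN *.
have := congr1 (fun h : {mps R[n]} => h (m + U_(i))%MM) fg0.
rewrite mulrC scoefM scoef0.
have lt_m : (mdeg m < (mdeg (m + U_(i))%MM).+1)%N by rewrite mdegD; lia.
rewrite (bigD1 (BMultinom lt_m)) /=; last by rewrite lem_addr.
have -> : (m + U_(i) - m = U_(i))%MM by rewrite addmC addmK.
rewrite big1 ?addr0 => [E|k /andP[le_k ne_k]].
  by rewrite -[g m](mulrK fu) E mul0r.
have Ek := submK le_k; move: ne_k; rewrite eqE /=.
set c := (_ - _)%MM in Ek *; clearbody c; move: (bmnm k) Ek => {le_k}k Ek ne_k.
have degE := congr1 mdeg Ek; rewrite !mdegD mdeg1 in degE.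
have iE : (c i + k i = 1 + m i)%N.
  by have /mnmP/(_ i) := Ek; rewrite !mnmDE mnm1E eqxx /=; lia.
have [c0|c0] := eqVneq (mdeg c) 0%N.
  by move/eqP: c0; rewrite mdeg_eq0 => /eqP ->; rewrite f0 mulr0.
have := le_deg k; have := le_deg m; have := le_deg c => lc lm lk.
rewrite IH ?mul0r // /W.
have [lt1|] := ltnP (c i) (mdeg c); first by move: leN; rewrite /W; lia.
move=> le1; have [lt2|] := ltnP 1 (mdeg c); first by move: leN; rewrite /W; lia.
move=> le2; have /mdeg1P[j /eqP cE] : mdeg c == 1%N by lia.
have ij : i = j.
  move: le1; rewrite cE mdeg1 mnm1E; by case: eqP.
by case/negP: ne_k; apply/eqP; move: Ek; rewrite cE -ij [RHS]addmC => /addmI.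
Qed.

(** Multiplication by a variable turns the unit constant term into a unit linear coefficient, the
    case of [mps_regular]. *)
Lemma mps_unit_regular (R : comUnitRingType) (n : nat) (f g : {mps R[n.+1]}) :
  f 0%MM \is a GRing.unit -> f * g = 0 -> g = 0.
Proof.
move=> fu fg0; apply: (@mps_regular _ _ (mpsX ord0 * f) g ord0).
- by rewrite scoefM0 nilX mul0r.
- by rewrite scoefMU nilX mul0r add0r scoefX eqxx mul1r.
- by rewrite -mulrA fg0 mulr0.
Qed.

Lemma mps2_decomp (R : comNzRingType) (f : {mps R[2]}) : f 0%MM = 0 ->
  exists A B : {mps R[2]}, f = mpsX 0 * A + mpsX 1 * B.
Proof.
move=> f0; pose g := f - mpsX 0 * mshift 0 f.
(* [mshift 0 f] collects the monomials involving the first variable. The remainder [g] involves only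
   the second one and has no constant term. *)
exists (mshift 0 f), (mshift 1 g); rewrite -(@mpsX_mshift _ _ 1 g) => [|m m1].
  by rewrite /g addrC subrK.
rewrite scoefB -monU scoef_monM; case: ifPn => [le_m|nle].
  by rewrite scoef_shift submK ?subrr.
suff -> : m = 0%MM by rewrite f0 subr0.
have m0 : m 0 = 0%N.
  apply/eqP; rewrite -leqn0 leqNgt; apply: contra nle => lt_m.
  by apply/mnm_lepP => j; rewrite mnm1E; case: eqP => // <-.
apply/mnmP => -[[|[|//]] lt]; rewrite mnm0E.
  by rewrite -[RHS]m0; congr (m _); apply: val_inj.
by rewrite -[RHS]m1; congr (m _); apply: val_inj.
Qed.

(** * Cancellation of polynomial factors and comparison of roots *)

Section PolyCancel.
Variable A : comNzRingType.
Implicit Types p q : {poly A}.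

Lemma poly_regular p q : (forall a, p`_0 * a = 0 -> a = 0) ->
  p * q = 0 -> q = 0.
Proof.
move=> reg pq0; apply/polyP => i; rewrite coef0.
elim/ltn_ind: i => i IH; apply: reg.
have := congr1 (fun r : {poly A} => r`_i) pq0.
rewrite coefM coef0 big_ord_recl subn0 big1 ?addr0 // => j _.
by rewrite IH ?mulr0 //= /bump; have := ltn_ord j; lia.
Qed.

(** Products of factors 1 + a t have constant term 1, so they cancel whatever the zero divisors of
    the ring. *)
Lemma poly1_cancel p q r : p`_0 = 1 -> p * q = p * r -> q = r.
Proof.
move=> p0 E; apply/eqP; rewrite -subr_eq0; apply/eqP.
apply: (@poly_regular p); first by move=> a; rewrite p0 mul1r.
by rewrite mulrBr E subrr.
Qed.

Lemma poly_sqr_inj p q : (forall a : A, 2%:R * a = 0 -> a = 0) ->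
  p`_0 = 1 -> q`_0 = 1 -> p ^+ 2 = q ^+ 2 -> p = q.
Proof.
move=> reg2 p0 q0 E; apply/eqP; rewrite -subr_eq0; apply/eqP.
apply: (@poly_regular (p + q)); first by rewrite coefD p0 q0.
by rewrite mulrC -subr_sqr E subrr.
Qed.

(** Reversing the coefficients of the product of the 1 + a t amounts to putting t = 1 / z and
    clearing denominators, here without any division. *)
Lemma coef_prod_root (s : seq A) (z : A) :
  \sum_(l < (size s).+1) (\prod_(a <- s) (1 + a%:P * 'X))`_l * z ^+ (size s - l)
  = \prod_(a <- s) (z + a).
Proof.
elim: s => [|a s IH]; first by rewrite big_ord1 !big_nil coef1 mulr1.
rewrite !big_cons -IH [RHS]mulrDl.
set p := \prod_(a <- s) _.
have sp : p`_(size s).+1 = 0.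
  apply: nth_default; rewrite /p; elim: (s) => [|b t IHt].
    by rewrite big_nil size_poly1.
  rewrite big_cons (leq_trans (size_polyMleq _ _)) //.
  have : (size (1 + b%:P * 'X : {poly A})%R <= 2)%N.
    apply/leq_sizeP => -[|[|j]] // _.
    by rewrite coefD coef1 coefCM coefX mulr0 addr0.
  move: IHt => /=; lia.
rewrite !mulr_sumr.
under eq_bigr => l _ do rewrite mulrDl mul1r coefD -mulrA coefCM coefXM mulrDl.
rewrite big_split /=; congr (_ + _).
  rewrite big_ord_recr /= sp mul0r addr0; apply: eq_bigr => l _.
  by rewrite subSn 1?exprS; [ring|have := ltn_ord l; lia].
rewrite big_ord_recl /= mulr0 mul0r add0r; apply: eq_bigr => l _.
by rewrite /= mulrA.
Qed.

(* The left-hand side of [coef_prod_root] evaluates the product at the root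
   [t = -1 / a], after homogenization. *)
Lemma prod_root_eq0 (s1 s2 : seq A) a : size s1 = size s2 -> a \in s1 ->
  \prod_(b <- s1) (1 + b%:P * 'X) = \prod_(b <- s2) (1 + b%:P * 'X) ->
  \prod_(b <- s2) (b - a) = 0.
Proof.
move=> sz as1 E; have := coef_prod_root s2 (- a); rewrite -E -sz coef_prod_root.
rewrite (big_rem a) //= addNr mul0r => ->.
by apply: eq_bigr => b _; rewrite addrC.
Qed.

Lemma prod2_root_eq0 (a1 a2 b1 b2 : A) :
  (1 + a1%:P * 'X) * (1 + a2%:P * 'X) = (1 + b1%:P * 'X) * (1 + b2%:P * 'X) ->
  (b1 - a1) * (b2 - a1) = 0.
Proof.
move=> E; have := @prod_root_eq0 [:: a1; a2] [:: b1; b2] a1.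
by rewrite !big_cons !big_nil !mulr1; apply=> //; rewrite mem_head.
Qed.

(** The factor [b1 - a1] is placed innermost: in the application the three others are regular and
    are stripped off from the left. *)
Lemma prod4_root_eq0 (a1 a2 a3 a4 b1 b2 b3 b4 : A) :
  (1 + a1%:P * 'X) * (1 + a2%:P * 'X) * (1 + a3%:P * 'X) * (1 + a4%:P * 'X)
  = (1 + b1%:P * 'X) * (1 + b2%:P * 'X) * (1 + b3%:P * 'X) * (1 + b4%:P * 'X) ->
  (b2 - a1) * ((b3 - a1) * ((b4 - a1) * (b1 - a1))) = 0.
Proof.
move=> E; have := @prod_root_eq0 [:: a1; a2; a3; a4] [:: b1; b2; b3; b4] a1.
rewrite !big_cons !big_nil !mulr1 !mulrA => H; rewrite -H ?mem_head //.
by rewrite mulrC !mulrA.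
Qed.

End PolyCancel.

(** * Series in one variable and compositional inverses *)

Lemma course_of_values (T : Type) (phi : seq T -> T) :
  exists c : nat -> T, forall n, c n = phi (mkseq c n).
Proof.
pose L := fix L n := if n is n'.+1 then rcons (L n') (phi (L n')) else [::].
exists (phi \o L) => n /=; congr phi; elim: n => // n IH.
by rewrite mkseqS -IH.
Qed.

Section OneVariable.
Variable R : comNzRingType.
Implicit Types f g h : {mps R[1]}.

Definition mon1 n : 'X_{1..1} := (U_(ord0) *+ n)%MM.

Lemma mdeg_mon1 n : mdeg (mon1 n) = n.
Proof. by rewrite mdegMn mdeg1 mul1n. Qed.

Lemma mon1_mdeg m : mon1 (mdeg m) = m.
Proof.
by apply/mnmP => i; rewrite mulmnE mdegE big_ord1 mnm1E (ord1 i) eqxx mul1n.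
Qed.

Lemma big_mon1 n (P : pred 'X_{1..1}) (F : 'X_{1..1} -> R) :
  \sum_(a : 'X_{1..1 < n.+1} | P a) F a
  = \sum_(k < n.+1 | P (mon1 k)) F (mon1 k).
Proof.
have lt (k : 'I_n.+1) : (mdeg (mon1 k) < n.+1)%N by rewrite mdeg_mon1.
rewrite (reindex (fun k => BMultinom (lt k))) //=.
exists (fun a : 'X_{1..1 < n.+1} => inord (mdeg a)) => [k _|a _].
  by apply: val_inj; rewrite /= mdeg_mon1 inordK.
by apply: val_inj; rewrite /= inordK ?mon1_mdeg //; case: a.
Qed.

Lemma scoef_msubst_mon1 n (g : {mps R[n]}) h m : (msubst [tuple g] h) m
  = \sum_(k < (mdeg m).+1) h (mon1 k) * (g ^+ k) m.
Proof.
rewrite scoef_msubst (big_mon1 _ predT (fun a => h a *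
  (\prod_(i < 1) tnth [tuple g] i ^+ a i) m)).
by apply: eq_bigr => k _; rewrite big_ord1 mulmnE mnm1E eqxx mul1n.
Qed.

Lemma msubst1_0 n (h : {mps R[1]}) :
  h 0%MM = 0 -> msubst [tuple 0] h = 0 :> {mps R[n]}.
Proof.
move=> h0; apply: mpsP => m; rewrite scoef_msubst_mon1 big_ord_recl.
have -> : mon1 (ord0 : 'I_(mdeg m).+1) = 0%MM by rewrite /mon1 mulm0n.
by rewrite h0 mul0r add0r big1 // => k _; rewrite expr0n scoef0 mulr0.
Qed.

Lemma scoefM_mon1 f g n : (f * g) (mon1 n)
  = \sum_(k < n.+1) f (mon1 k) * g (mon1 (n - k)).
Proof.
rewrite scoefM mdeg_mon1 (big_mon1 _ (fun k => (k <= mon1 n)%MM)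
  (fun k => f k * g (mon1 n - k)%MM)).
apply: eq_big => [k|k _].
  by apply/mnm_lepP => i; rewrite !mulmnE leq_mul2l -ltnS ltn_ord orbT.
by congr (_ * g _); apply/mnmP => i; rewrite mnmBE !mulmnE mulnBr.
Qed.

Lemma mps1_dvd g : g 0%MM = 0 -> g = mpsX ord0 * mshift ord0 g.
Proof.
move=> g0; apply: mpsX_mshift => m m0.
by rewrite -(mon1_mdeg m) mdegE big_ord1 m0 /mon1 mulm0n.
Qed.

Lemma scoef_expr_mon1 g n : g 0%MM = 0 ->
  (g ^+ n) (mon1 n) = (g U_(ord0)%MM) ^+ n.
Proof.
move=> g0; rewrite (mps1_dvd g0).
rewrite exprMn_comm; last exact: mulrC.
have -> : mpsX ord0 ^+ n = mon (mon1 n) :> {mps R[1]}.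
  by rewrite mon_prod big_ord1 mulmnE mnm1E eqxx mul1n.
rewrite scoef_monM lepm_refl.
have -> : (mon1 n - mon1 n = 0)%MM by rewrite -{1}[mon1 n]add0m addmK.
rewrite scoefMU nilX mul0r add0r scoefX eqxx mul1r.
by elim: n => [|n IH]; rewrite ?exprS ?scoefM0 ?IH // expr0 scoef1 eqxx.
Qed.

End OneVariable.

Arguments mon1 n : simpl never.

Section CompositionalInverse.
Variable R : comUnitRingType.
Implicit Types f g h : {mps R[1]}.

Lemma left_comp_inv g : g 0%MM = 0 -> g U_(ord0)%MM \is a GRing.unit ->
  exists h : {mps R[1]}, [/\ h 0%MM = 0, h U_(ord0)%MM \is a GRing.unit
    & msubst [tuple g] h = mpsX ord0].
Proof.
move=> g0 gu; pose u := g U_(ord0)%MM.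
(* The coefficient of degree n in h(g) is h_n u^n plus terms in h_0, ..., h_(n-1). [phi] solves for
   h_n, the target being 1 in degree 1 and 0 elsewhere. *)
pose phi (s : seq R) := let n := size s in u ^- n *
  ((n == 1)%:R - \sum_(k < n) s`_k * (g ^+ k) (mon1 n)).
have [c cE] := course_of_values phi.
have [h hE] : exists h : {mps R[1]}, forall n, h (mon1 n) = c n.
  by exists (MPS (fun m => c (mdeg m))) => n /=; rewrite mdeg_mon1.
have inv : msubst [tuple g] h = mpsX ord0.
  apply: mpsP => m; rewrite -(mon1_mdeg m); move: (mdeg m) => n {m}.
  rewrite scoef_msubst_mon1 mdeg_mon1 big_ord_recr /=.
  rewrite scoef_expr_mon1 // !hE -/u cE /phi size_mkseq mulrC mulrA.
  rewrite mulrV ?unitrX // mul1r.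
  rewrite (eq_bigr (fun k : 'I_n => (mkseq c n)`_k * (g ^+ k) (mon1 n))).
    rewrite addrC subrK; congr (nat_of_bool _)%:R.
    apply/eqP/eqP => [->|/(congr1 (@mdeg _))]; first by rewrite /mon1 mulm1n.
    by rewrite mdeg_mon1 mdeg1.
  by move=> k _; rewrite hE nth_mkseq.
have h0 : h 0%MM = 0.
  by rewrite -(mon1_mdeg 0%MM) mdeg0 hE cE /phi /= big_ord0 subr0 mulr0.
exists h; split=> //.
have := congr1 (fun f : {mps R[1]} => f U_(ord0)%MM) inv.
rewrite scoefU_msubst1 // scoefX eqxx => E.
by apply/unitrPr; exists u.
Qed.

Lemma comp_invP g : g 0%MM = 0 -> g U_(ord0)%MM \is a GRing.unit ->
  [/\ comp_inv g 0%MM = 0, msubst [tuple comp_inv g] g = mpsX ord0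
    & msubst [tuple g] (comp_inv g) = mpsX ord0].
Proof.
move=> g0 gu; rewrite /comp_inv; case: pselect => [ex|[]].
  by case: (cid ex) => h [].
(* If h(g) = X and k(h) = X, then substituting g in the second identity gives k = g, so that h is a
   two-sided inverse. *)
have [h [h0 hu hg]] := left_comp_inv g0 gu.
have [k [k0 ku kh]] := left_comp_inv h0 hu.
have E : k = g.
  have := congr1 (msubst [tuple g]) kh.
  by rewrite msubst_comp1 ?hg ?msubst_id1 ?msubst_var1 //; nil.
by exists h; split=> //; rewrite -E.
Qed.

End CompositionalInverse.

(** * The binomial series of the square root *)

Section HalfBinomial.
Variable R : comUnitRingType.
Hypothesis h2 : (2%:R : R) \is a GRing.unit.

(** This is the integer 4^k binom(1/2, k). Over [int] a factor k + 1 can be cancelled, whereas it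
    may be a zero divisor in [R]. *)
Definition cbin (k : nat) : int :=
  if k is j.+1 then (-1) ^+ j * (2 * ('C(j.*2, j) %/ j.+1))%:R else 1.

(** Coefficientwise, this is the differential equation (1 + 4t) s' = 2s of s = sqrt(1 + 4t). *)
Lemma cbinS k : k.+1%:R * cbin k.+1 = (2%:R - 4%:R * k%:R) * cbin k.
Proof.
case: k => [|j]; first by [].
rewrite /cbin exprS; have := catalanS j; set a := (_ %/ j.+2)%N.
set b := (_ %/ j.+1)%N => E.
have := congr1 (fun n => n%:R : int) E.
rewrite -[j.*2.+1]addn1 -muln2 !natrM !natrD !natrM -[in j.+2%:R]natr1.
rewrite -[j.+1%:R]natr1 => E'.
transitivity (- (-1) ^+ j * 2 * ((j%:R + 1 + 1) * a%:R : int)); first by ring.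
by rewrite E'; ring.
Qed.

Definition cbin_conv n : int := \sum_(i < n.+1) cbin i * cbin (n - i).

(** The differential equation (1 + 4t) e' = 4e for e = s^2, from e' = 2 s s'. The factor on the
    right vanishes at n = 1, which stops the series at e = 1 + 4t. *)
Lemma cbin_convS n :
  n.+1%:R * cbin_conv n.+1 = (4%:R - 4%:R * n%:R) * cbin_conv n.
Proof.
pose s (F : nat -> nat -> int) m := \sum_(i < m.+1) F i (m - i)%N.
have sC F m : s F m = s (fun i j => F j i) m.
  rewrite /s (reindex_inj rev_ord_inj) /=; apply: eq_bigr => i _.
  by rewrite subSS subKn // -ltnS.
pose A i j := i%:R * cbin i * cbin j.
have E m : m%:R * cbin_conv m = 2%:R * s A m.
  have -> : 2%:R * s A m = s (fun i j => A j i) m + s A m.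
    by rewrite -sC; ring.
  rewrite /s -big_split mulr_sumr /=.
  apply: eq_bigr => i _; rewrite /A.
  have -> : m%:R = (m - i)%:R + i%:R :> int.
    by rewrite -natrD subnK // -ltnS.
  by ring.
have E1 : s A n.+1 = s (fun i j => (2%:R - 4%:R * i%:R) * cbin i * cbin j) n.
  rewrite /s big_ord_recl /A /= !mul0r add0r; apply: eq_bigr => i _.
  by rewrite /bump /= add1n cbinS subSS.
have E2 : s (fun i j => (2%:R - 4%:R * i%:R) * cbin i * cbin j) n
   = 2%:R * cbin_conv n - 4%:R * s A n.
  rewrite /s /cbin_conv !mulr_sumr -sumrB; apply: eq_bigr => i _.
  by rewrite /A; ring.
rewrite E E1 E2 mulrBr mulrA mulrCA -E; ring.
Qed.

Lemma cbin_conv0 n : cbin_conv n.+2 = 0.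
Proof.
elim: n => [|n IH]; have := cbin_convS.
  move/(_ 1%N); rewrite mulr1 subrr mul0r => /eqP.
  by rewrite mulf_eq0 => /orP[//|/eqP].
move/(_ n.+2); rewrite IH mulr0 => /eqP.
by rewrite mulf_eq0 Num.Theory.pnatr_eq0 => /eqP.
Qed.

Lemma half_binom_cbin k : half_binom R k = (cbin k)%:~R / 4%:R ^+ k.
Proof.
case: k => [|j]; first by rewrite expr0 divr1.
by rewrite /half_binom /cbin rmorphM rmorphXn rmorphN rmorph1 rmorph_nat.
Qed.

Lemma unit4 : (4%:R : R) \is a GRing.unit.
Proof. by rewrite (_ : 4 = 2 * 2)%N // natrM unitrM h2. Qed.

Lemma half_binom_conv n :
  \sum_(i < n.+1) half_binom R i * half_binom R (n - i) = (n <= 1)%:R.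
Proof.
have -> : \sum_(i < n.+1) half_binom R i * half_binom R (n - i)
    = (cbin_conv n)%:~R / 4%:R ^+ n.
  rewrite /cbin_conv rmorph_sum mulr_suml; apply: eq_bigr => i _.
  rewrite !half_binom_cbin rmorphM /= mulrACA -!exprVn -exprD.
  by rewrite subnKC // -ltnS.
case: n => [|[|n]]; last by rewrite cbin_conv0 mul0r.
  by rewrite expr0 divr1 /cbin_conv big_ord1 mulr1.
rewrite expr1 /cbin_conv 2!big_ord_recl big_ord0 /= /cbin /=.
by rewrite divrr ?unit4.
Qed.

Lemma sqrt1_sqr n (w : {mps R[n]}) : w 0%MM = 0 -> sqrt1 w ^+ 2 = 1 + w.
Proof.
move=> w0; have w1 := topnil1 w0.
pose s : {mps R[1]} := MPS (fun m => half_binom R (mdeg m)).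
have sE k : s (mon1 k) = half_binom R k by rewrite /s /= mdeg_mon1.
have -> : sqrt1 w = msubst [tuple w] s.
  apply: mpsP => m; rewrite scoef_msubst_mon1.
  by apply: eq_bigr => k _; rewrite sE.
rewrite -msubstXn // (_ : s ^+ 2 = 1 + mpsX ord0).
  by rewrite msubstD msubst1 // msubst_var1.
apply: mpsP => m; rewrite -(mon1_mdeg m); move: (mdeg m) => k {m}.
rewrite expr2 scoefM_mon1 scoefD scoef1 scoefX.
under eq_bigr => i _ do rewrite !sE; rewrite half_binom_conv.
rewrite -mdeg_eq0 mdeg_mon1.
have -> : (mon1 k == U_(ord0)%MM) = (k == 1%N).
  apply/eqP/eqP => [/(congr1 (@mdeg _))|->]; last by rewrite /mon1 mulm1n.
  by rewrite mdeg_mon1 mdeg1.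
by case: k => [|[|k]] /=; rewrite ?addr0 ?add0r.
Qed.
End HalfBinomial.

(** * Substitution in polynomials, and evaluation of root products *)

Local Notation lin a := (1 + a%:P * 'X).

Section PolySubst.
Variables (R : comNzRingType) (n k : nat) (g : n.-tuple {mps R[k]}).
Hypothesis g0 : topnil g.
Implicit Types (f : {mps R[n]}) (G H : {poly {mps R[n]}}).

Let tsubstE : tsubst g = map_poly (msubst_morph g0). Proof. by []. Qed.

Lemma tsubstM G H : tsubst g (G * H) = tsubst g G * tsubst g H.
Proof. by rewrite tsubstE rmorphM. Qed.
Lemma tsubstD G H : tsubst g (G + H) = tsubst g G + tsubst g H.
Proof. by rewrite tsubstE rmorphD. Qed.
Lemma tsubstB G H : tsubst g (G - H) = tsubst g G - tsubst g H.
Proof. by rewrite tsubstE rmorphB. Qed.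
Lemma tsubst1 : tsubst g 1 = 1.
Proof. by rewrite tsubstE rmorph1. Qed.
Lemma tsubstXn G j : tsubst g (G ^+ j) = tsubst g G ^+ j.
Proof. by rewrite tsubstE rmorphXn. Qed.
Lemma tsubst_prod (I : Type) (r : seq I) (P : pred I) (F : I -> _) :
  tsubst g (\prod_(i <- r | P i) F i) = \prod_(i <- r | P i) tsubst g (F i).
Proof. by rewrite tsubstE rmorph_prod. Qed.
Lemma tsubst_C f : tsubst g f%:P = (msubst g f)%:P.
Proof. by rewrite tsubstE map_polyC. Qed.
Lemma tsubst_X : tsubst g 'X = 'X.
Proof. by rewrite tsubstE map_polyX. Qed.
Lemma tsubst_lin f : tsubst g (lin f) = lin (msubst g f).
Proof. by rewrite tsubstD tsubstM tsubst1 tsubst_C tsubst_X. Qed.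
Lemma tsubst_comp_poly G H : tsubst g (G \Po H) = tsubst g G \Po tsubst g H.
Proof. by rewrite tsubstE map_comp_poly. Qed.
Lemma coef_tsubst G j : (tsubst g G)`_j = msubst g G`_j.
Proof. by rewrite tsubstE coef_map. Qed.

End PolySubst.

Lemma tsubst_comp (R : comNzRingType) (n k l : nat) (g : n.-tuple {mps R[k]})
    (h : k.-tuple {mps R[l]}) (G : {poly {mps R[n]}}) : topnil g -> topnil h ->
  tsubst h (tsubst g G) = tsubst [tuple of map (msubst h) g] G.
Proof.
move=> g0 h0; have gh0 : topnil [tuple of map (msubst h) g].
  by move=> i; rewrite tnth_map scoef0_msubst.
apply/polyP => j; rewrite coef_tsubst // coef_tsubst // coef_tsubst //.
by rewrite msubst_comp.
Qed.

Lemma tsubst_comp3 (R : comNzRingType) (k l : nat) (h : k.-tuple {mps R[l]})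
    (G : {poly {mps R[3]}}) (a b c : {mps R[k]}) : topnil h ->
  a 0%MM = 0 -> b 0%MM = 0 -> c 0%MM = 0 ->
  tsubst h (tsubst [tuple a; b; c] G)
  = tsubst [tuple msubst h a; msubst h b; msubst h c] G.
Proof.
move=> h0 a0 b0 c0; rewrite tsubst_comp //; last exact: topnil3.
by congr (tsubst _ G); apply: val_inj.
Qed.

Section RootProducts.
Variables (R : comNzRingType) (k m p : nat).
Variables (a : k.-tuple {mps R[p]}) (b : m.-tuple {mps R[p]}).
Hypotheses (a0 : topnil a) (b0 : topnil b).

Lemma topnil_cat : topnil [tuple of a ++ b].
Proof.
by move=> i; case: (split_ordP i) => j ->; rewrite ?tnth_lshift ?tnth_rshift.
Qed.

Let base0 : topnil [tuple (mpsX (lshift m j) : {mps R[k + m]}) | j < k].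
Proof. by move=> i; rewrite tnth_mktuple nilX. Qed.

Let map_base : [tuple of map (msubst [tuple of a ++ b])
   [tuple (mpsX (lshift m j) : {mps R[k + m]}) | j < k]] = a.
Proof.
apply: eq_from_tnth => i; rewrite tnth_map tnth_mktuple.
by rewrite msubst_X ?tnth_lshift //; apply: topnil_cat.
Qed.

Lemma msubst_base f : msubst [tuple of a ++ b] (base m f) = msubst a f.
Proof. by rewrite msubst_comp ?map_base //; apply: topnil_cat. Qed.

Lemma tsubst_base G : tsubst [tuple of a ++ b] (tbase m G) = tsubst a G.
Proof. by rewrite tsubst_comp ?map_base //; apply: topnil_cat. Qed.

Lemma msubst_root i : msubst [tuple of a ++ b] (root_var R k i) = tnth b i.
Proof. by rewrite msubst_X ?tnth_rshift //; apply: topnil_cat. Qed.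

(* A family [b] of roots of the specialization of [G] at [a] makes the
   splitting ideal vanish. *)
Lemma root_prod_eval G H T (K : 'I_m -> {poly {mps R[p]}}) :
  is_root_prod G H T -> \prod_(i < m) lin (tnth b i) = tsubst a G ->
  (forall i, tsubst [tuple of a ++ b] (H (root_var R k i)) = K i) ->
  \prod_(i < m) K i = tsubst a T.
Proof.
have ab0 := topnil_cat; move=> HT E HK.
rewrite -(eq_bigr _ (fun i _ => HK i)); apply/polyP => j; have [q] := HT j.
move/(congr1 (msubst [tuple of a ++ b])); rewrite msubst_sum //.
rewrite [X in _ = X -> _]big1 => [|l _]; last first.
  rewrite msubstM // -coef_tsubst // tsubstB // tsubst_base tsubst_prod //.
  under eq_bigr => i _ do rewrite tsubst_lin // msubst_root.
  by rewrite E subrr coef0 mulr0.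
rewrite -coef_tsubst // tsubstB // coefB tsubst_base tsubst_prod //.
by move/eqP; rewrite subr_eq0 => /eqP.
Qed.

End RootProducts.

(** * The axioms evaluated at arbitrary topologically nilpotent points *)

Section Pointwise.
Variables (R : comUnitRingType) (gr : grading R).
Hypothesis h2 : (2%:R : R) \is a GRing.unit.
Variables (Psi : {mps R[1]}) (F : {poly {mps R[3]}}).
Hypothesis ftlF : formal_ternary_law gr Psi F.

Lemma mps_2reg n (f : {mps R[n]}) : 2%:R * f = 0 -> f = 0.
Proof.
move=> E; apply: mpsP => m; have := congr1 (fun g : {mps R[n]} => g m) E.
by rewrite scoef_natM !scoef0 => /(congr1 (fun c => 2%:R^-1 * c));
  rewrite mulKr // mulr0.
Qed.

Section Points.
Variable p : nat.
Implicit Types a b c d e r s u v w : {mps R[p]}.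

Definition ps a := msubst [tuple a] Psi.
Definition io a := msubst [tuple a] (iota_of Psi).
Definition Fl a b c := tsubst [tuple a; b; c] F.

Lemma nilPsi : Psi 0%MM = 0. Proof. by case: (ftl_involution ftlF). Qed.

Lemma nil_iota : iota_of Psi 0%MM = 0.
Proof.
by rewrite /iota_of scoefB nilX scoef_natM nilPsi mulr0 subr0.
Qed.

Lemma nil_ps a : a 0%MM = 0 -> ps a 0%MM = 0.
Proof. by move=> a0; apply: nil_msubst nilPsi; nil. Qed.
Lemma nil_io a : a 0%MM = 0 -> io a 0%MM = 0.
Proof. by move=> a0; apply: nil_msubst nil_iota; nil. Qed.

Lemma ioE a : a 0%MM = 0 -> io a = a - 2%:R * ps a.
Proof.
move=> a0; have t : topnil [tuple a] by nil.
by rewrite /io msubstB // msubstM // msubst_nat // msubst_var1.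
Qed.

Lemma ioK a : a 0%MM = 0 -> io (io a) = a.
Proof.
move=> a0; have [_ _ _ E] := ftl_involution ftlF.
rewrite -[RHS](msubst_var1 ord0 a0) -E msubst_comp1 //; first by nil.
exact: nil_iota.
Qed.

(** Expanding iota(iota a) = a with iota = id - 2 Psi gives twice this identity, and 2 is
    regular. *)
Lemma ps_io a : a 0%MM = 0 -> ps (io a) = - ps a.
Proof.
move=> a0; apply/eqP; rewrite -subr_eq0; apply/eqP; apply: mps_2reg.
have := ioK a0; rewrite (ioE (nil_io a0)) => E.
have -> : 2%:R * (ps (io a) - - ps a)
    = io a + 2%:R * ps a - (io a - 2%:R * ps (io a)) by ring.
by rewrite E ioE //; ring.
Qed.

Let Psi1 : Psi U_(ord0)%MM = 1. Proof. by case: (ftl_involution ftlF). Qed.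

Lemma ps_inj a b : a 0%MM = 0 -> b 0%MM = 0 -> ps a = ps b -> a = b.
Proof.
move=> a0 b0 /(congr1 (fun c => msubst [tuple c] (comp_inv Psi))).
have [|h0 _ E] := @comp_invP _ Psi nilPsi; first by rewrite Psi1 unitr1.
rewrite /ps -!msubst_comp1 ?E ?msubst_var1 //; nil; exact: nilPsi.
Qed.

Lemma scoefU_ps a j : a 0%MM = 0 -> ps a U_(j)%MM = a U_(j)%MM.
Proof. by move=> a0; rewrite scoefU_msubst1 // Psi1 mul1r. Qed.

Lemma scoefU_io a j : a 0%MM = 0 -> io a U_(j)%MM = - a U_(j)%MM.
Proof.
by move=> a0; rewrite ioE // scoefB scoef_natM scoefU_ps //; ring.
Qed.

Lemma io0 : io 0 = 0.
Proof. by rewrite /io msubst1_0 ?nil_iota. Qed.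

Lemma Fl0 a b c : a 0%MM = 0 -> b 0%MM = 0 -> c 0%MM = 0 -> (Fl a b c)`_0 = 1.
Proof.
move=> a0 b0 c0; have t : topnil [tuple a; b; c] by nil.
by rewrite coef_tsubst //; case: (ftl_series ftlF) => -> _ _; rewrite msubst1.
Qed.

Lemma Fl_unit a : a 0%MM = 0 -> Fl a 0 0 = lin a ^+ 2 * lin (io a) ^+ 2.
Proof.
move=> a0; have t : topnil [tuple a] by nil.
have /= := congr1 (tsubst [tuple a]) (ftl_unit ftlF).
rewrite tsubst_comp3; [|by nil..].
by rewrite tsubstM // !tsubstXn // !tsubst_lin // msubst_var1 // msubst0.
Qed.

Lemma Fl_perm (t : 3.-tuple {mps R[p]}) (s : 'S_3) : topnil t ->
  tsubst [tuple tnth t (s i) | i < 3] F = tsubst t F.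
Proof.
move=> t0; rewrite -[in RHS](ftl_sym ftlF s) tsubst_comp //; last first.
  by move=> i; rewrite tnth_mktuple nilX.
congr (tsubst _ F); apply: eq_from_tnth => i.
by rewrite tnth_map !tnth_mktuple msubst_X.
Qed.

Lemma Fl_swap12 a b c : a 0%MM = 0 -> b 0%MM = 0 -> c 0%MM = 0 ->
  Fl a b c = Fl b a c.
Proof.
move=> a0 b0 c0; rewrite /Fl -[RHS](Fl_perm (tperm 0 1)); last by nil.
congr (tsubst _ F); apply: eq_from_tnth => i; rewrite tnth_mktuple.
by case: i => [[|[|[|//]]] lt]; rewrite permE /=.
Qed.

Lemma Fl_swap23 a b c : a 0%MM = 0 -> b 0%MM = 0 -> c 0%MM = 0 ->
  Fl a b c = Fl a c b.
Proof.
move=> a0 b0 c0; rewrite /Fl -[RHS](Fl_perm (tperm 1 2%:R)); last by nil.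
congr (tsubst _ F); apply: eq_from_tnth => i; rewrite tnth_mktuple.
by case: i => [[|[|[|//]]] lt]; rewrite permE /=.
Qed.

Lemma prod_ord4 (A : comNzRingType) (f : 'I_4 -> A) :
  \prod_(i < 4) f i = f 0 * f 1 * f 2%:R * f 3%:R.
Proof.
rewrite !big_ord_recl big_ord0 mulr1 !mulrA.
by congr (f _ * f _ * f _ * f _); apply: val_inj.
Qed.

(** The axiom compares two splitting algebras through a common product T. At series that are actual
    roots on both sides, it becomes an identity of polynomials over power series. *)
Lemma Fl_assoc a b c d e r1 r2 r3 r4 s1 s2 s3 s4 :
  a 0%MM = 0 -> b 0%MM = 0 -> c 0%MM = 0 -> d 0%MM = 0 -> e 0%MM = 0 ->
  r1 0%MM = 0 -> r2 0%MM = 0 -> r3 0%MM = 0 -> r4 0%MM = 0 ->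
  s1 0%MM = 0 -> s2 0%MM = 0 -> s3 0%MM = 0 -> s4 0%MM = 0 ->
  lin r1 * lin r2 * lin r3 * lin r4 = Fl a b c ->
  lin s1 * lin s2 * lin s3 * lin s4 = Fl b c d ->
  Fl r1 d e * Fl r2 d e * Fl r3 d e * Fl r4 d e
  = Fl a s1 e * Fl a s2 e * Fl a s3 e * Fl a s4 e.
Proof.
move=> a0 b0 c0 d0 e0 r10 r20 r30 r40 s10 s20 s30 s40 Er Es.
have [T [HT1 HT2]] := ftl_assoc ftlF.
have ta : topnil [tuple a; b; c; d; e] by nil.
have tr : topnil [tuple r1; r2; r3; r4] by nil.
have ts : topnil [tuple s1; s2; s3; s4] by nil.
have X i : (mpsX i : {mps R[5]}) 0%MM = 0 by apply: nilX.
have bX i : (base 4 (mpsX i) : {mps R[5 + 4]}) 0%MM = 0.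
  by apply: nil_msubst (X i) => j; rewrite tnth_mktuple nilX.
have rX i : (root_var R 5 i : {mps R[5 + 4]}) 0%MM = 0 by apply: nilX.
have tar := topnil_cat ta tr; have tas := topnil_cat ta ts.
have HK1 i : tsubst [tuple of [tuple a; b; c; d; e] ++ [tuple r1; r2; r3; r4]]
    (tsubst [tuple root_var R 5 i; base 4 (mpsX 3%:R); base 4 (mpsX 4%:R)] F)
  = Fl (tnth [tuple r1; r2; r3; r4] i) d e.
  by rewrite (tsubst_comp3 _ tar) // msubst_root // !msubst_base // !msubst_X.
have HK2 i : tsubst [tuple of [tuple a; b; c; d; e] ++ [tuple s1; s2; s3; s4]]
    (tsubst [tuple base 4 (mpsX 0); root_var R 5 i; base 4 (mpsX 4%:R)] F)
  = Fl a (tnth [tuple s1; s2; s3; s4] i) e.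
  by rewrite (tsubst_comp3 _ tas) // msubst_root // !msubst_base // !msubst_X.
have := root_prod_eval ta tr HT1 _ HK1; have := root_prod_eval ta ts HT2 _ HK2.
rewrite !prod_ord4 !(tsubst_comp3 _ ta) // !msubst_X // => H2 H1.
by have := H1 Er; rewrite -(H2 Es).
Qed.

(** F(a, 0, 0) and F(0, 0, b) have the double roots a, iota a and b, iota b. Both sides of
    associativity therefore share the factor F(a, b, c)^2; the squares that remain have equal roots
    because the constant terms are 1 and 2 is regular. *)
Lemma Fl_io a b c : a 0%MM = 0 -> b 0%MM = 0 -> c 0%MM = 0 ->
  Fl (io a) b c = Fl a (io b) c.
Proof.
move=> a0 b0 c0; have ia0 := nil_io a0; have ib0 := nil_io b0.
have z0 := nil0 R p.
have Fb : Fl 0 0 b = Fl b 0 0 by rewrite Fl_swap23 // Fl_swap12.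
have : Fl a b c * Fl a b c * Fl (io a) b c * Fl (io a) b c
    = Fl a b c * Fl a b c * Fl a (io b) c * Fl a (io b) c.
  apply: (@Fl_assoc a 0 0); rewrite ?Fb // Fl_unit //; ring.
rewrite -!mulrA => /poly1_cancel E; apply: (poly_sqr_inj (@mps_2reg p)).
- exact: Fl0.
- exact: Fl0.
rewrite !expr2; apply: (@poly1_cancel _ (Fl a b c)); first exact: Fl0.
by apply: E; apply: Fl0.
Qed.

(** The transport applies Psi^-1 to the arguments and Psi to the roots, so at [ps a], [ps b], [ps c]
    its roots are Psi of those of F(a, b, c). Passing from a to iota a changes the sign of [ps a],
    and there parity applies. *)
Lemma Fl_parity a b c r1 r2 r3 r4 s1 s2 s3 s4 :
  a 0%MM = 0 -> b 0%MM = 0 -> c 0%MM = 0 ->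
  r1 0%MM = 0 -> r2 0%MM = 0 -> r3 0%MM = 0 -> r4 0%MM = 0 ->
  s1 0%MM = 0 -> s2 0%MM = 0 -> s3 0%MM = 0 -> s4 0%MM = 0 ->
  lin r1 * lin r2 * lin r3 * lin r4 = Fl a b c ->
  lin s1 * lin s2 * lin s3 * lin s4 = Fl (io a) b c ->
  lin (ps s1) * lin (ps s2) * lin (ps s3) * lin (ps s4)
  = lin (- ps r1) * lin (- ps r2) * lin (- ps r3) * lin (- ps r4).
Proof.
move=> a0 b0 c0 r10 r20 r30 r40 s10 s20 s30 s40 Er Es.
have [Fh [HT Eh]] := ftl_parity ftlF.
have [|i0 _ Ei] := @comp_invP _ Psi nilPsi; first by rewrite Psi1 unitr1.
have P0 := nilPsi; have ia0 := nil_io a0.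
have ev d r1' r2' r3' r4' : d 0%MM = 0 ->
  r1' 0%MM = 0 -> r2' 0%MM = 0 -> r3' 0%MM = 0 -> r4' 0%MM = 0 ->
  lin r1' * lin r2' * lin r3' * lin r4' = Fl d b c ->
  lin (ps r1') * lin (ps r2') * lin (ps r3') * lin (ps r4')
  = tsubst [tuple ps d; ps b; ps c] Fh.
  move=> d0 r10' r20' r30' r40' E.
  have [pd pb pc] := And3 (nil_ps d0) (nil_ps b0) (nil_ps c0).
  have tp : topnil [tuple ps d; ps b; ps c] by nil.
  have tr : topnil [tuple r1'; r2'; r3'; r4'] by nil.
  have tpr := topnil_cat tp tr.
  have n1 (i : 'I_3) : topnil [tuple (mpsX i : {mps R[3]})].
    by apply: topnil1; apply: nilX.
  have psK u : u 0%MM = 0 -> msubst [tuple ps u] (comp_inv Psi) = u.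
    by move=> u0; rewrite /ps -msubst_comp1 ?Ei ?msubst_var1 //; nil.
  have root0 i : (root_var R 3 i : {mps R[3 + 4]}) 0%MM = 0 by apply: nilX.
  have HK i : tsubst [tuple of [tuple ps d; ps b; ps c]
      ++ [tuple r1'; r2'; r3'; r4']]
      (lin (msubst [tuple root_var R 3 i] Psi))
    = lin (ps (tnth [tuple r1'; r2'; r3'; r4'] i)).
    by rewrite tsubst_lin // msubst_comp1 // msubst_root.
  have := root_prod_eval tp tr HT _ HK; rewrite !prod_ord4.
  rewrite tsubst_comp //; last first.
    by move=> i; rewrite tnth_mktuple nil_msubst.
  have -> : [tuple of map (msubst [tuple ps d; ps b; ps c])
      [tuple msubst [tuple mpsX i] (comp_inv Psi) | i < 3]] = [tuple d; b; c].
    apply: eq_from_tnth => i; rewrite tnth_map tnth_mktuple.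
    rewrite msubst_comp1 // ?msubst_X //; last exact: nilX.
    by case: i => [[|[|[|//]]] lt]; rewrite !(tnth_nth 0) /= psK.
  exact.
rewrite (ev _ _ _ _ _ ia0 s10 s20 s30 s40 Es) ps_io //.
have [pd pb pc] := And3 (nil_ps a0) (nil_ps b0) (nil_ps c0).
have tp : topnil [tuple ps a; ps b; ps c] by nil.
have := congr1 (tsubst [tuple ps a; ps b; ps c]) Eh.
rewrite tsubst_comp3; [|by nil..].
rewrite msubstN // !msubst_X // tsubst_comp_poly // => ->.
rewrite -(ev _ _ _ _ _ a0 r10 r20 r30 r40 Er).
have linN u : lin u \Po tsubst [tuple ps a; ps b; ps c] (- 'X) = lin (- u).
  rewrite -[- 'X]sub0r tsubstB // tsubst_X // -polyC0 tsubst_C // msubst0 //.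
  rewrite polyC0 sub0r comp_polyD comp_polyM comp_polyC comp_polyX rmorph1.
  by rewrite comp_polyC polyCN mulrN mulNr.
by rewrite !comp_polyM !linN.
Qed.

(** The diagonal axiom only asserts that some S and P exist; the coefficients of t and t^2 identify
    them with the defined series. *)
Lemma FlS : exists S P : {mps R[2]}, [/\ ftl_S F = S, ftl_P F = P &
  tsubst [tuple mpsX 0; mpsX 0; mpsX 1] F
  = lin (mpsX 1) ^+ 2 * (1 + S%:P * 'X + P%:P * 'X ^+ 2)].
Proof.
have [S [P E]] := ftl_diag ftlF; exists S, P.
set y : {mps R[2]} := mpsX 1 in E *.
have E' : tsubst [tuple mpsX 0; mpsX 0; y] F = 1 + (S + 2%:R * y)%:P * 'X
  + (P + 2%:R * y * S + y ^+ 2)%:P * 'X^2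
  + (2%:R * y * P + y ^+ 2 * S)%:P * 'X^3 + (y ^+ 2 * P)%:P * 'X^4.
  by rewrite E !(rmorphD, rmorphM, rmorphXn) /= !polyC1; ring.
have E1 : ftl_S F = S.
  by rewrite /ftl_S -/y E' !coefD !coefCM !coefXn coefX coef1 /=; ring.
split=> //.
by rewrite /ftl_P E1 -/y E' !coefD !coefCM !coefXn coefX coef1 /=; ring.
Qed.

Definition Sx a b := msubst [tuple a; b] (ftl_S F).
Definition Px a b := msubst [tuple a; b] (ftl_P F).

Lemma Fl_diag a b : a 0%MM = 0 -> b 0%MM = 0 ->
  Fl a a b = lin b ^+ 2 * (1 + (Sx a b)%:P * 'X + (Px a b)%:P * 'X ^+ 2).
Proof.
move=> a0 b0; have t : topnil [tuple a; b] by nil.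
have [S [P [SE PE E]]] := FlS.
have := congr1 (tsubst [tuple a; b]) E.
rewrite tsubst_comp3; [|by nil..].
rewrite tsubstM // tsubstXn // tsubst_lin // tsubstD // tsubst_lin //.
rewrite (tsubstM _ P%:P) // tsubstXn // tsubst_C // tsubst_X //.
rewrite !msubst_var20 // !msubst_var21 //.
by rewrite /Sx /Px SE PE.
Qed.

Lemma coef0_lin2 (u : {mps R[p]}) : (lin u ^+ 2 : {poly {mps R[p]}})`_0 = 1.
Proof.
by rewrite expr2 coef0M coefD coef1 coefCM coefX mulr0 addr0 mulr1.
Qed.

Lemma coef_diag (u v : {mps R[p]}) :
  ((1 + u%:P * 'X + v%:P * 'X ^+ 2 : {poly {mps R[p]}})`_1 = u) *
  ((1 + u%:P * 'X + v%:P * 'X ^+ 2 : {poly {mps R[p]}})`_2 = v).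
Proof.
by split; rewrite !coefD !coefCM coefXn coefX coef1 /=; ring.
Qed.

Lemma SP_eq a b a' b' : a 0%MM = 0 -> b 0%MM = 0 -> a' 0%MM = 0 ->
  Fl a a b = Fl a' a' b -> Sx a b = Sx a' b /\ Px a b = Px a' b.
Proof.
move=> a0 b0 a'0; rewrite !Fl_diag // => /poly1_cancel E.
have {}E := E (coef0_lin2 b).
have := congr1 (fun G : {poly {mps R[p]}} => G`_1) E; rewrite !coef_diag.
by have := congr1 (fun G : {poly {mps R[p]}} => G`_2) E; rewrite !coef_diag.
Qed.

(** Moving one iota to the other argument, F(iota a, iota a, b) = F(a, iota(iota a), b) = F(a, a,
    b). *)
Lemma SP_io a b : a 0%MM = 0 -> b 0%MM = 0 ->
  Sx (io a) b = Sx a b /\ Px (io a) b = Px a b.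
Proof.
move=> a0 b0; have ia0 := nil_io a0; apply: SP_eq => //.
by rewrite Fl_io // ioK.
Qed.

Lemma SP_0 b : b 0%MM = 0 ->
  Sx 0 b = 2%:R * io b /\ Px 0 b = io b ^+ 2.
Proof.
move=> b0; have ib0 := nil_io b0; have z0 := nil0 R p.
have := Fl_diag z0 b0; rewrite Fl_swap23 // Fl_swap12 // Fl_unit //.
move/poly1_cancel => E; have {}E := E (coef0_lin2 b).
have E' : lin (io b) ^+ 2
    = 1 + (2%:R * io b)%:P * 'X + (io b ^+ 2)%:P * 'X ^+ 2.
  by rewrite !(rmorphM, rmorphXn) /= polyC_natr; ring.
rewrite E' in E.
have := congr1 (fun G : {poly {mps R[p]}} => G`_1) E; rewrite !coef_diag.
by have := congr1 (fun G : {poly {mps R[p]}} => G`_2) E; rewrite !coef_diag.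
Qed.

End Points.

(** * Terms of order two, which decide the leading coefficient of the discriminant *)

Section Quadratic.

(** The exponent has the shape that two applications of [mshift] produce. *)
Definition quad (f : {mps R[1]}) := f (0 + U_(ord0) + U_(ord0))%MM.

Lemma quad_prod (u v w : {mps R[1]}) : u 0%MM = 0 -> v 0%MM = 0 ->
  quad (u * v * w) = u U_(ord0)%MM * v U_(ord0)%MM * w 0%MM.
Proof.
move=> u0 v0; rewrite {1}(mps1_dvd u0) {1}(mps1_dvd v0).
set u' := mshift _ u; set v' := mshift _ v.
have -> : mpsX ord0 * u' * (mpsX ord0 * v') * w
    = mpsX ord0 * (mpsX ord0 * (u' * v' * w)) by ring.
rewrite -[quad _]/(mshift ord0 (mshift ord0 _) 0%MM) !mshiftK !scoefM0.
by rewrite !scoef_shift !add0m.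
Qed.

Lemma quadM (u v : {mps R[1]}) : u 0%MM = 0 -> v 0%MM = 0 ->
  quad (u * v) = u U_(ord0)%MM * v U_(ord0)%MM.
Proof.
by move=> u0 v0; rewrite -[u * v]mulr1 quad_prod // scoef1 eqxx mulr1.
Qed.

(** Second-order Taylor formula along a curve through the origin: splitting off a variable twice
    writes [f] as a quadratic form with power series coefficients, of which only the constant terms
    matter here. *)
Lemma quad_form (f : {mps R[2]}) :
  f 0%MM = 0 -> f U_(0%R)%MM = 0 -> f U_(1%R)%MM = 0 ->
  exists al be ga : R, forall a b : {mps R[1]}, a 0%MM = 0 -> b 0%MM = 0 ->
    quad (msubst [tuple a; b] f) = al * a U_(ord0)%MM ^+ 2
      + be * (a U_(ord0)%MM * b U_(ord0)%MM) + ga * b U_(ord0)%MM ^+ 2.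
Proof.
move=> f0 fx fy; have [A [B E]] := mps2_decomp f0.
have A0 : A 0%MM = 0.
  move: fx; rewrite E scoefD !scoefMU !nilX !scoefX !mul0r !add0r eqxx mul1r.
  by case: eqP => [/mnmP/(_ 0)|_]; rewrite ?mnm1E // mul0r addr0.
have B0 : B 0%MM = 0.
  move: fy; rewrite E scoefD !scoefMU !nilX !scoefX !mul0r !add0r eqxx mul1r.
  by case: eqP => [/mnmP/(_ 0)|_]; rewrite ?mnm1E // mul0r add0r.
have [A1 [A2 EA]] := mps2_decomp A0; have [B1 [B2 EB]] := mps2_decomp B0.
exists (A1 0%MM), (A2 0%MM + B1 0%MM), (B2 0%MM) => a b a0 b0.
have t : topnil [tuple a; b] by nil.
rewrite E EA EB !(msubstD, msubstM, mulrDr) //.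
rewrite !msubst_var20 // !msubst_var21 //.
rewrite !mulrA /quad !scoefD -!/(quad _) !quad_prod // !scoef0_msubst //.
by ring.
Qed.

End Quadratic.

Lemma Fl_io3 p (a b c : {mps R[p]}) :
  a 0%MM = 0 -> b 0%MM = 0 -> c 0%MM = 0 -> Fl a (io b) c = Fl a b (io c).
Proof.
move=> a0 b0 c0; have ib0 := nil_io b0; have ic0 := nil_io c0.
by rewrite Fl_swap12 // Fl_swap23 // Fl_io // Fl_swap12 // Fl_swap23 //
  Fl_swap12 // Fl_swap23 // Fl_swap12.
Qed.

Let z : {mps R[1]} := mpsX ord0.
Let z0 : z 0%MM = 0. Proof. exact: nilX. Qed.
Let zU : z U_(ord0)%MM = 1. Proof. by rewrite scoefX eqxx. Qed.

Lemma scoef0_F l : F`_l.+1 0%MM = 0.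
Proof.
have o0 := nil0 R 1; have t : topnil [tuple 0; 0; (0 : {mps R[1]})] by nil.
rewrite -(scoef0_msubst t) -coef_tsubst // -/(Fl _ _ _) Fl_unit // io0.
by rewrite polyC0 mul0r addr0 !expr1n mulr1 coef1.
Qed.

Lemma coef_unit12 p (a : {mps R[p]}) : a 0%MM = 0 ->
  ((Fl a 0 0)`_1 = 2%:R * (a + io a)) *
  ((Fl a 0 0)`_2 = a * a + 4%:R * (a * io a) + io a * io a).
Proof.
move=> a0; rewrite Fl_unit //.
have -> : lin a ^+ 2 * lin (io a) ^+ 2 = 1 + (2%:R * (a + io a))%:P * 'X
   + (a * a + 4%:R * (a * io a) + io a * io a)%:P * 'X^2
   + (2%:R * a * io a * (a + io a))%:P * 'X^3 + (a ^+ 2 * io a ^+ 2)%:P * 'X^4.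
  by rewrite !(rmorphD, rmorphM, rmorphXn) /= ?polyC_natr; ring.
by split; rewrite !coefD !coefCM !coefXn coefX coef1 /=; ring.
Qed.

(** F_1(x, 0, 0) = 2(x + iota x) has no linear term, since iota x begins with -x; by symmetry the
    same holds for the second variable. *)
Lemma scoefU_F1 :
  msubst [tuple z; z; 0] F`_1 U_(ord0)%MM = 0.
Proof.
have o0 := nil0 R 1; have iz := nil_io z0.
have E (a b c : {mps R[1]}) : a 0%MM = 0 -> b 0%MM = 0 -> c 0%MM = 0 ->
    msubst [tuple a; b; c] F`_1 U_(ord0)%MM
    = F`_1 U_(0%R)%MM * a U_(ord0)%MM + F`_1 U_(1%R)%MM * b U_(ord0)%MM
      + F`_1 U_(2%:R)%MM * c U_(ord0)%MM.
  move=> a0 b0 c0; rewrite scoefU_msubst; last by nil.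
  rewrite 3!big_ord_recl big_ord0 addr0 addrA.
  by congr (F`_1 U_(_)%MM * _ + F`_1 U_(_)%MM * _ + F`_1 U_(_)%MM * _);
    apply: val_inj.
have c0 : (Fl z 0 0)`_1 U_(ord0)%MM = 0.
  rewrite coef_unit12 // scoef_natM scoefD scoefU_io // zU; ring.
have t1 : topnil [tuple z; 0; 0] by nil.
have t2 : topnil [tuple 0; z; 0] by nil.
have := c0; rewrite Fl_swap12 // coef_tsubst // E // !scoef0 zU.
have := c0; rewrite coef_tsubst // E // !scoef0 zU !mulr0 !addr0 !mulr1.
by rewrite E // scoef0 !zU => -> ; rewrite add0r => ->; ring.
Qed.

Lemma coef_diag0 p (a : {mps R[p]}) : a 0%MM = 0 ->
  (Sx a 0 = msubst [tuple a; a; 0] F`_1)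
  * (Px a 0 = msubst [tuple a; a; 0] F`_2).
Proof.
move=> a0; have o0 := nil0 R p; have t : topnil [tuple a; a; 0] by nil.
rewrite -!coef_tsubst // -/(Fl _ _ _) Fl_diag // polyC0 mul0r addr0 expr1n.
by rewrite mul1r !coef_diag.
Qed.

(** To leading order F_t(x, 0, 0) is (1 - x^2 t^2)^2, so each pure square contributes -2. The mixed
    coefficient [be] changes sign under x -> iota x in one argument, whereas F(iota x, x, 0) = F(x,
    x, 0); hence it vanishes. *)
Lemma quad_F2 : quad (msubst [tuple z; z; 0] F`_2) = - 4%:R.
Proof.
have o0 := nil0 R 1; have iz := nil_io z0.
have X i : (mpsX i : {mps R[2]}) 0%MM = 0 by apply: nilX.
have t2 : topnil [tuple mpsX 0; mpsX 1; (0 : {mps R[2]})] by nil.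
pose f : {mps R[2]} := msubst [tuple mpsX 0; mpsX 1; 0] F`_2.
have fE (a b : {mps R[1]}) : a 0%MM = 0 -> b 0%MM = 0 ->
    msubst [tuple a; b] f = (Fl a b 0)`_2.
  move=> a0 b0; have t : topnil [tuple a; b] by nil.
  have t3 : topnil [tuple a; b; 0] by nil.
  rewrite /f msubst_comp3 // coef_tsubst // msubst0 //.
  by rewrite msubst_var20 ?msubst_var21.
have f0 : f 0%MM = 0 by rewrite scoef0_msubst // scoef0_F.
have fz : (Fl z 0 0)`_2 U_(ord0)%MM = 0.
  by rewrite coef_unit12 // !scoefD scoef_natM !scoefMU z0 iz; ring.
have fx : f U_(0%R)%MM = 0.
  have := fz; rewrite -fE // scoefU_msubst2 // zU scoef0.
  by rewrite mulr0 addr0 mulr1.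
have fy : f U_(1%R)%MM = 0.
  have := fz; rewrite Fl_swap12 // -fE // scoefU_msubst2 // zU scoef0.
  by rewrite mulr0 add0r mulr1.
have [al [be [ga Q]]] := quad_form f0 fx fy.
have qz : quad (Fl z 0 0)`_2 = - 2%:R.
  rewrite coef_unit12 // /quad !scoefD scoef_natM -!/(quad _) !quadM //.
  by rewrite scoefU_io // zU; ring.
have Eal : al = - 2%:R.
  by have := Q z 0 z0 o0; rewrite fE // qz zU scoef0 => ->; ring.
have Ega : ga = - 2%:R.
  by have := Q 0 z o0 z0; rewrite fE // Fl_swap12 // qz zU scoef0 => ->; ring.
have Ebe : be = 0.
  have Ez : Fl (io z) z 0 = Fl z z 0 by rewrite Fl_io // Fl_io3 // io0.
  have E := Q _ _ iz z0; rewrite fE // Ez -fE // Q // scoefU_io // zU in E.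
  apply: (mulrI h2); rewrite mulr0.
  have -> : 2%:R * be = (al * 1 ^+ 2 + be * (1 * 1) + ga * 1 ^+ 2)
    - (al * (-1) ^+ 2 + be * (-1 * 1) + ga * 1 ^+ 2) by ring.
  by rewrite -E subrr.
have t3 : topnil [tuple z; z; 0] by nil.
rewrite -coef_tsubst // -/(Fl _ _ _) -fE // Q // Eal Ega Ebe zU; ring.
Qed.

(** * The discriminant and its square root *)

Let x : {mps R[2]} := mpsX 0.
Let y : {mps R[2]} := mpsX 1.
Let x0 : x 0%MM = 0. Proof. exact: nilX. Qed.
Let y0 : y 0%MM = 0. Proof. exact: nilX. Qed.

Definition Dx p (a b : {mps R[p]}) := msubst [tuple a; b] (ftl_D F).

Lemma DxE p (a b : {mps R[p]}) : a 0%MM = 0 -> b 0%MM = 0 ->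
  Dx a b = Sx a b ^+ 2 - 4%:R * Px a b.
Proof.
move=> a0 b0; have t : topnil [tuple a; b] by nil.
by rewrite /Dx /ftl_D msubstB // msubstXn // msubstM // msubst_nat.
Qed.

Definition D2 := div_sqr 0 (ftl_D F).

(* [D] vanishes on [x = 0] and is invariant under [x -> iota x = - x + ...]. *)
Lemma ftl_D_sqr : ftl_D F = x * (x * D2).
Proof.
have o0 := nil0 R 2; have ix := nil_io x0; have jy := nil_io y0.
have D0 (b : {mps R[2]}) : b 0%MM = 0 -> Dx 0 b = 0.
  by move=> b0; rewrite DxE //; have [-> ->] := SP_0 b0; ring.
have E1 := mpsX0_dvd (D0 y y0); set D1 := mshift 0 _ in E1.
have ty : topnil [tuple 0; y] by nil.
have ti : topnil [tuple io x; y] by nil.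
have iE : io x = x * mshift 0 (io x).
  apply: mpsX0_dvd; rewrite /io msubst_comp1 ?nil_iota // msubst_var20 //.
  by rewrite -/(io _) io0.
set J := mshift 0 _ in iE.
have J0 : J 0%MM = -1.
  by rewrite /J scoef_shift add0m scoefU_io // scoefX eqxx.
(* The invariance of D divided by x: as iota x = x J, D(iota x, y) = x J D1(iota x, y). *)
have inv : J * msubst [tuple io x; y] D1 = D1.
  apply: (@mpsX_inj _ _ 0); rewrite -E1 mulrA -/x -iE.
  transitivity (Dx (io x) y).
    by rewrite /Dx [ftl_D F]E1 msubstM // msubst_var20.
  rewrite DxE //; have [-> ->] := SP_io x0 y0; rewrite -DxE //.
  by rewrite /Dx msubst_id2.
(* At x = 0 the invariance reads (1 - J(0, y)) D1(0, y) = 0, and the first factor has constant term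
   2. *)
have D10 : msubst [tuple 0; y] D1 = 0.
  apply: (@mps_unit_regular _ _ (1 - msubst [tuple 0; y] J)).
    by rewrite scoefB scoef1 eqxx scoef0_msubst // J0 opprK.
  have := congr1 (msubst [tuple 0; y]) inv; rewrite msubstM // msubst_comp2 //.
  rewrite /io msubst_comp1 ?nil_iota // msubst_var20 // msubst_var21 //.
  rewrite -/(io _) io0 => E.
  by rewrite mulrBl mul1r E subrr.
by rewrite {1}E1 (mpsX0_dvd D10); congr (_ * (_ * _)).
Qed.

Lemma scoefU_S : (ftl_S F U_(0%R)%MM = 0) * (ftl_S F U_(1%R)%MM = - 2%:R).
Proof.
have o0 := nil0 R 1; split.
  have : Sx z 0 U_(ord0)%MM = 0 by rewrite coef_diag0 // scoefU_F1.
  by rewrite /Sx scoefU_msubst2 // zU scoef0 mulr0 addr0 mulr1.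
have : Sx 0 z U_(ord0)%MM = - 2%:R.
  by have [-> _] := SP_0 z0; rewrite scoef_natM scoefU_io // zU; ring.
by rewrite /Sx scoefU_msubst2 // zU scoef0 mulr0 add0r mulr1.
Qed.

(** On y = 0 the series S has no linear term and P begins with -4 x^2, so S^2 - 4P begins with 16
    x^2. *)
Lemma D2_0 : D2 0%MM = 16%:R.
Proof.
have o0 := nil0 R 1; have t : topnil [tuple z; 0] by nil.
have := congr1 (fun f => quad (msubst [tuple z; 0] f)) ftl_D_sqr.
rewrite -/(Dx z 0) DxE // mulrA !msubstM // msubst_var20 // quad_prod //.
rewrite zU scoef0_msubst // !mul1r => <-.
have s0 : Sx z 0 0%MM = 0.
  rewrite coef_diag0 // scoef0_msubst ?scoef0_F //; nil.
have -> : Sx z 0 ^+ 2 - 4%:R * Px z 0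
    = Sx z 0 * Sx z 0 + - 4%:R * Px z 0 by ring.
rewrite /quad scoefD -(mpsC_nat _ _ 4).
have -> : - mpsC 4%:R = mpsC (- 4%:R) :> {mps R[1]}.
  by apply: mpsP => m; rewrite scoefN !scoefC mulNrn.
rewrite scoefCM -!/(quad _) quadM // !coef_diag0 // scoefU_F1 quad_F2; ring.
Qed.

Let unit16 : (16%:R : R) \is a GRing.unit.
Proof. by rewrite (_ : 16 = 4 * 4)%N // natrM unitrM unit4. Qed.

Let dq := mpsC (16%:R^-1) * D2 - 1 : {mps R[2]}.

Let dq0 : dq 0%MM = 0.
Proof. by rewrite scoefB scoefCM D2_0 mulVr // scoef1 eqxx subrr. Qed.

Lemma sqrtD_sqr : ftl_sqrtD F ^+ 2 = ftl_D F.
Proof.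
rewrite /ftl_sqrtD -/D2 -/dq exprMn_comm; last exact: mulrC.
rewrite sqrt1_sqr // {1}/dq addrC subrK ftl_D_sqr.
have -> : (4%:R * x) ^+ 2 * (mpsC (16%:R^-1) * D2)
    = 16%:R * mpsC (16%:R^-1) * (x * (x * D2)) by ring.
by rewrite -mpsC_nat -mpsC_morph mulrV // mpsC1 mul1r.
Qed.

Lemma scoef0_sqrt1 n (v : {mps R[n]}) : sqrt1 v 0%MM = 1.
Proof. by rewrite /sqrt1 /= mdeg0 big_ord1 expr0 scoef1 eqxx mulr1. Qed.

Lemma scoef_sqrtD : [/\ ftl_sqrtD F 0%MM = 0, ftl_sqrtD F U_(0%R)%MM = 4%:R
  & ftl_sqrtD F U_(1%R)%MM = 0].
Proof.
rewrite /ftl_sqrtD -mulrA; split.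
- by rewrite scoef_natM scoefM0 x0 mul0r mulr0.
- by rewrite scoef_natM scoefMU x0 mul0r add0r scoef0_sqrt1 scoefX eqxx !mulr1.
rewrite scoef_natM scoefMU x0 mul0r add0r scoef0_sqrt1 scoefX.
by case: eqP => [/mnmP/(_ 0)|_]; rewrite ?mnm1E // mul0r mulr0.
Qed.

Lemma nilS : ftl_S F 0%MM = 0.
Proof.
have o0 := nil0 R 1; have t : topnil [tuple 0; (0 : {mps R[1]})] by nil.
rewrite -(scoef0_msubst t) -/(Sx _ _); have [-> _] := SP_0 o0.
by rewrite io0 mulr0.
Qed.

(** * The two roots, and how the involution acts on them *)

Definition ftl_B' : {mps R[2]} := mpsC (2%:R^-1) * (ftl_S F + ftl_sqrtD F).

Let half2 n : 2%:R * mpsC (2%:R^-1) = 1 :> {mps R[n]}.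
Proof. by rewrite -mpsC_nat -mpsC_morph mulrV // mpsC1. Qed.

Lemma BD : ftl_B F + ftl_B' = ftl_S F.
Proof.
rewrite /ftl_B /ftl_B'; set h := mpsC _.
have -> : h * (ftl_S F - ftl_sqrtD F) + h * (ftl_S F + ftl_sqrtD F)
  = 2%:R * h * ftl_S F by ring.
by rewrite half2 mul1r.
Qed.

Lemma BM : ftl_B F * ftl_B' = ftl_P F.
Proof.
rewrite /ftl_B /ftl_B'; set h := mpsC _.
have -> : h * (ftl_S F - ftl_sqrtD F) * (h * (ftl_S F + ftl_sqrtD F))
  = h ^+ 2 * (ftl_S F ^+ 2 - ftl_sqrtD F ^+ 2) by ring.
rewrite sqrtD_sqr /ftl_D.
have -> : h ^+ 2 * (ftl_S F ^+ 2 - (ftl_S F ^+ 2 - 4%:R * ftl_P F))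
   = (2%:R * h) ^+ 2 * ftl_P F by ring.
by rewrite half2 expr1n mul1r.
Qed.

Lemma nilB : ftl_B F 0%MM = 0.
Proof.
by case: scoef_sqrtD => d _ _; rewrite scoefCM scoefB nilS d subrr mulr0.
Qed.
Lemma nilB' : ftl_B' 0%MM = 0.
Proof.
by case: scoef_sqrtD => d _ _; rewrite scoefCM scoefD nilS d addr0 mulr0.
Qed.

Section Roots.
Variable p : nat.
Implicit Types a b c d : {mps R[p]}.

Definition Bm a b := msubst [tuple a; b] (ftl_B F).
Definition Bp a b := msubst [tuple a; b] ftl_B'.

Lemma nil_Bm a b : a 0%MM = 0 -> b 0%MM = 0 -> Bm a b 0%MM = 0.
Proof. by move=> a0 b0; apply: nil_msubst nilB; nil. Qed.
Lemma nil_Bp a b : a 0%MM = 0 -> b 0%MM = 0 -> Bp a b 0%MM = 0.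
Proof. by move=> a0 b0; apply: nil_msubst nilB'; nil. Qed.

Lemma scoefU_Bm a b j : a 0%MM = 0 -> b 0%MM = 0 ->
  Bm a b U_(j)%MM = - 2%:R * a U_(j)%MM - b U_(j)%MM.
Proof.
move=> a0 b0; rewrite scoefU_msubst2 // !scoefCM !(scoefB (ftl_S F)) !scoefU_S.
case: scoef_sqrtD => _ -> ->; rewrite sub0r subr0 mulrN.
by rewrite (_ : 4%:R = 2%:R * 2%:R) ?mulKr ?mulrN ?mulVr //; ring.
Qed.

Lemma scoefU_Bp a b j : a 0%MM = 0 -> b 0%MM = 0 ->
  Bp a b U_(j)%MM = 2%:R * a U_(j)%MM - b U_(j)%MM.
Proof.
move=> a0 b0; rewrite scoefU_msubst2 // !scoefCM !(scoefD (ftl_S F)) !scoefU_S.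
case: scoef_sqrtD => _ -> ->; rewrite add0r addr0.
by rewrite (_ : 4%:R = 2%:R * 2%:R) ?mulKr ?mulrN ?mulVr //; ring.
Qed.

Lemma BpD a b : a 0%MM = 0 -> b 0%MM = 0 -> Bm a b + Bp a b = Sx a b.
Proof.
by move=> a0 b0; rewrite /Bm /Bp -msubstD BD.
Qed.

Lemma BpM a b : a 0%MM = 0 -> b 0%MM = 0 -> Bm a b * Bp a b = Px a b.
Proof.
move=> a0 b0; have t : topnil [tuple a; b] by nil.
by rewrite -msubstM // BM.
Qed.

(** Besides F(a, 0, 0), this is the family of points whose four roots are explicit. *)
Lemma Fl_roots a b : a 0%MM = 0 -> b 0%MM = 0 ->
  Fl a a b = lin b * lin b * lin (Bm a b) * lin (Bp a b).
Proof.
move=> a0 b0; rewrite Fl_diag // -BpD // -BpM //.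
by rewrite !(rmorphD, rmorphM) /=; ring.
Qed.

Lemma BmE a b : Bm a b = msubst [tuple a; b] (ftl_B F). Proof. by []. Qed.
Lemma BpE a b : Bp a b = msubst [tuple a; b] ftl_B'. Proof. by []. Qed.

End Roots.

(* Otherwise failing unification attempts unfold the roots. *)
Opaque Bm Bp.

Lemma regular_eq n (u v g : {mps R[n]}) j : u 0%MM = 0 -> v 0%MM = 0 ->
  u U_(j)%MM - v U_(j)%MM \is a GRing.unit -> (u - v) * g = 0 -> g = 0.
Proof.
move=> u0 v0 un; apply: (@mps_regular _ _ _ _ j) => //.
by rewrite scoefB u0 v0 subrr.
Qed.

Lemma scoefXU n (i j : 'I_n) :
  (mpsX i : {mps R[n]}) U_(j)%MM = (i == j)%:R.
Proof.
rewrite scoefX; congr (nat_of_bool _)%:R; apply/eqP/eqP => [|-> //].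
by move/mnmP/(_ i); rewrite !mnm1E eqxx; case: eqP => // ->.
Qed.

Let unit4N : (- 4%:R : R) \is a GRing.unit.
Proof. by rewrite unitrN unit4. Qed.

Section UniversalIdentities.
Let ix0 := nil_io x0.
Let iy0 := nil_io y0.
Let lE := (scoefU_Bm, scoefU_Bp, scoefU_io, scoefXU).

(** By the invariance of S and P, B(iota x, y) solves the quadratic equation of B(x, y) and B'(x,
    y). Its difference with B(x, y) has x-coefficient 4, hence is regular, and the other factor
    vanishes. *)
Lemma Bm_io_var : Bm (io x) y = Bp x y.
Proof.
have Bm0 := nil_Bm x0 y0; have Bi0 := nil_Bm ix0 y0.
apply/eqP; rewrite -subr_eq0; apply/eqP.
apply: (@regular_eq _ (Bm (io x) y) (Bm x y) _ 0) => //.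
  rewrite !lE //=; have -> : - 2%:R * - 1 - 0 - (- 2%:R * 1 - 0) = 4%:R :> R.
    by ring.
  exact: unit4.
have [ES EP] := SP_io x0 y0.
have -> : (Bm (io x) y - Bm x y) * (Bm (io x) y - Bp x y)
  = Bm (io x) y ^+ 2 - Bm (io x) y * (Bm x y + Bp x y) + Bm x y * Bp x y.
  by ring.
by rewrite BpD // BpM // -ES -EP -BpD // -BpM //; ring.
Qed.

(** Parity is applied to F(y, x, x), with roots y, y, B, B'. The factors of y cancel since Psi(iota
    y) = - Psi(y); the two remaining roots are matched by their x-coefficients, and Psi is
    injective. *)
Lemma Bm_iy_var : Bm x (io y) = io (Bp x y).
Proof.
have B0 := nil_Bm x0 y0; have B'0 := nil_Bp x0 y0.
have G0 := nil_Bm x0 iy0; have G'0 := nil_Bp x0 iy0.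
have Er : lin y * lin y * lin (Bm x y) * lin (Bp x y) = Fl y x x.
  by rewrite -(Fl_roots x0 y0) (Fl_swap23 x0 x0 y0) (Fl_swap12 x0 y0 x0).
have Es : lin (io y) * lin (io y) * lin (Bm x (io y)) * lin (Bp x (io y))
    = Fl (io y) x x.
  by rewrite -(Fl_roots x0 iy0) (Fl_swap23 x0 x0 iy0) (Fl_swap12 x0 iy0 x0).
have := Fl_parity y0 x0 x0 y0 y0 B0 B'0 iy0 iy0 G0 G'0 Er Es.
rewrite ps_io // -!mulrA => /poly1_cancel E; have l0 : (lin (- ps y))`_0 = 1.
  by rewrite coefD coef1 coefCM coefX mulr0 addr0.
have {E l0}E := poly1_cancel l0 (E l0).
apply: ps_inj => //; first exact: nil_io.
rewrite ps_io //; apply/eqP; rewrite -addr_eq0 addrC; apply/eqP.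
apply: (@regular_eq _ (- ps (Bm x y)) (ps (Bm x (io y))) _ 0).
- exact: nilN (nil_ps B0).
- exact: nil_ps.
- rewrite scoefN !scoefU_ps // !lE //=.
  have -> : - (- 2%:R * 1 - 0) - (- 2%:R * 1 - - 0) = 4%:R :> R by ring.
  exact: unit4.
by have := prod2_root_eq0 E => {}E; rewrite -[RHS]oppr0 -E; ring.
Qed.

End UniversalIdentities.

Lemma Bm_io p (a b : {mps R[p]}) : a 0%MM = 0 -> b 0%MM = 0 ->
  Bm (io a) b = Bp a b.
Proof.
move=> a0 b0; have t : topnil [tuple a; b] by nil.
have := congr1 (msubst [tuple a; b]) Bm_io_var.
rewrite !BmE !BpE /io !msubst_comp2 ?msubst_comp1 ?nil_iota //; last first.
  exact: nil_io.
by rewrite msubst_var20 // msubst_var21.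
Qed.

Lemma Bm_iy p (a b : {mps R[p]}) : a 0%MM = 0 -> b 0%MM = 0 ->
  Bm a (io b) = io (Bp a b).
Proof.
move=> a0 b0; have t : topnil [tuple a; b] by nil.
have := congr1 (msubst [tuple a; b]) Bm_iy_var.
have n1 := nil_io y0; have n2 := nil_Bp x0 y0.
rewrite !BmE /io msubst_comp2 // !msubst_comp1 // !BpE !msubst_comp2 //.
by rewrite msubst_var20 // msubst_var21.
Qed.

(** * Symmetry of the twofold iterates of the roots *)

Section Iterate.
Variable p : nat.
Variables a b c : {mps R[p]}.
Hypotheses (a0 : a 0%MM = 0) (b0 : b 0%MM = 0) (c0 : c 0%MM = 0).

Let Fl_cyc (u v w : {mps R[p]}) : u 0%MM = 0 -> v 0%MM = 0 -> w 0%MM = 0 ->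
  Fl u v w = Fl v w u.
Proof. by move=> u0 v0 w0; rewrite Fl_swap12 // Fl_swap23. Qed.

(* Both sides are [F(F(a, a, b), c, c)].  The chain of associativities only
   involves triples with a repeated entry, for which the roots are explicit. *)
Lemma Fl_iter :
  Fl b c c * Fl b c c * Fl (Bm a b) c c * Fl (Bp a b) c c
  = Fl b a a * Fl b a a * Fl (Bm c b) a a * Fl (Bp c b) a a.
Proof.
have [ab ab'] := conj (nil_Bm a0 b0) (nil_Bp a0 b0).
have [ac ac'] := conj (nil_Bm a0 c0) (nil_Bp a0 c0).
have [ca ca'] := conj (nil_Bm c0 a0) (nil_Bp c0 a0).
have [cb cb'] := conj (nil_Bm c0 b0) (nil_Bp c0 b0).
have E1 := @Fl_assoc _ b a a c c _ _ _ _ _ _ _ _ b0 a0 a0 c0 c0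
  b0 b0 ab ab' c0 c0 ac ac'.
rewrite {}E1; last by rewrite -Fl_roots.
  (* A cyclic rotation puts the roots of F(a, a, c) back in the first slot, so that associativity
     applies again, at (a, a, c, c, b) and, after one more rotation, at (a, c, c, b, a). *)
  rewrite !(@Fl_cyc b _ c) //.
  have E2 := @Fl_assoc _ a a c c b _ _ _ _ _ _ _ _ a0 a0 c0 c0 b0
    c0 c0 ac ac' a0 a0 ca ca'.
  rewrite {}E2; [|by rewrite -Fl_roots|by rewrite -Fl_roots // (@Fl_cyc a)].
  rewrite !(@Fl_cyc a _ b) //.
  have E3 := @Fl_assoc _ a c c b a _ _ _ _ _ _ _ _ a0 c0 c0 b0 a0
    a0 a0 ca ca' b0 b0 cb cb'.
  rewrite {}E3; [|by rewrite -Fl_roots // (@Fl_cyc a)|by rewrite -Fl_roots].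
  by rewrite !(@Fl_swap12 _ a _ a).
by rewrite -Fl_roots // (@Fl_cyc b).
Qed.

(** [l1] stands for the factor of b, [l2], [l3] for those of B and B' at (a, b), [l4], [l5] for
    those at (c, b); the [p] and [q] are the factors of the iterates. *)
Let cancel_common (A : comNzRingType) (l1 l2 l3 l4 l5 p1 p2 p3 p4
    q1 q2 q3 q4 : A) :
  l1 * l1 * l4 * l5 * (l1 * l1 * l4 * l5) * (l2 * l2 * p1 * p2)
    * (l3 * l3 * p3 * p4)
  = l1 * l1 * l2 * l3 * (l1 * l1 * l2 * l3) * (l4 * l4 * q1 * q2)
    * (l5 * l5 * q3 * q4) ->
  l1 ^+ 4 * (l2 ^+ 2 * l3 ^+ 2 * (l4 ^+ 2 * l5 ^+ 2)) * (p2 * p1 * p4 * p3)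
  = l1 ^+ 4 * (l2 ^+ 2 * l3 ^+ 2 * (l4 ^+ 2 * l5 ^+ 2))
    * (q2 * q1 * q4 * q3).
Proof.
move=> E; transitivity (l1 * l1 * l4 * l5 * (l1 * l1 * l4 * l5)
  * (l2 * l2 * p1 * p2) * (l3 * l3 * p3 * p4)); first by ring.
by rewrite E; ring.
Qed.

(** On the left of [Fl_iter] the square of F(b, c, c) brings b^4 and the squares of the roots at (c,
    b), and the other two factors bring the squares of the roots at (a, b). On the right a and c are
    exchanged, so the total [K] is the same and cancels. *)
Lemma prod_iter :
  lin (Bp c (Bm a b)) * lin (Bm c (Bm a b)) * lin (Bp c (Bp a b))
    * lin (Bm c (Bp a b))
  = lin (Bp a (Bm c b)) * lin (Bm a (Bm c b)) * lin (Bp a (Bp c b))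
    * lin (Bm a (Bp c b)).
Proof.
have E := Fl_iter; move: E.
have roots (u v : {mps R[p]}) : u 0%MM = 0 -> v 0%MM = 0 ->
    Fl u v v = lin u * lin u * lin (Bm v u) * lin (Bp v u).
  by move=> u0 v0; rewrite -Fl_roots // (@Fl_cyc u).
have [ab ab'] := conj (nil_Bm a0 b0) (nil_Bp a0 b0).
have [cb cb'] := conj (nil_Bm c0 b0) (nil_Bp c0 b0).
rewrite (roots _ _ b0 c0) (roots _ _ ab c0) (roots _ _ ab' c0).
rewrite (roots _ _ b0 a0) (roots _ _ cb a0) (roots _ _ cb' a0).
set K := lin b ^+ 4 * (lin (Bm a b) ^+ 2 * lin (Bp a b) ^+ 2
   * (lin (Bm c b) ^+ 2 * lin (Bp c b) ^+ 2)).
move=> E; apply: (@poly1_cancel _ K).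
  have l0 (u : {mps R[p]}) : (lin u)`_0 = 1.
    by rewrite coefD coef1 coefCM coefX mulr0 addr0.
  by rewrite /K !exprS !expr0 !coef0M !l0 coef1 !mulr1.
exact: cancel_common E.
Qed.

End Iterate.

(** The left-hand side begins with 2t + 2v + w, and the four candidates opposite with w plus or
    minus 2v plus or minus 2t. Three of them differ from it by -4 in the coefficient of v or of t,
    which leaves the fourth. *)
Lemma Bp_Bm_var (v : {mps R[3]} := mpsX 0) (w : {mps R[3]} := mpsX 1)
   (t : {mps R[3]} := mpsX 2%:R) : Bp t (Bm v w) = Bp v (Bm t w).
Proof.
have X i : (mpsX i : {mps R[3]}) 0%MM = 0 by apply: nilX.
have [v0 w0 t0] := And3 (X 0) (X 1) (X 2%:R).
rewrite -/v -/w -/t in v0 w0 t0.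
have [vw vw'] := conj (nil_Bm v0 w0) (nil_Bp v0 w0).
have [tw tw'] := conj (nil_Bm t0 w0) (nil_Bp t0 w0).
set r := Bp t _.
have r0 : r 0%MM = 0 := nil_Bp t0 vw.
have E0 := prod4_root_eq0 (prod_iter v0 w0 t0); rewrite -/r in E0.
have X00 : v U_(0%R)%MM = 1 by rewrite scoefXU.
have X01 : w U_(0%R)%MM = 0 by rewrite scoefXU.
have X02 : t U_(0%R)%MM = 0 by rewrite scoefXU.
have X20 : v U_(2%:R)%MM = 0 by rewrite scoefXU.
have X21 : w U_(2%:R)%MM = 0 by rewrite scoefXU.
have X22 : t U_(2%:R)%MM = 1 by rewrite scoefXU.
have r_0 : r U_(0%R)%MM = 2%:R.
  by rewrite (scoefU_Bp _ t0 vw) (scoefU_Bm _ v0 w0) X00 X01 X02; ring.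
have r_2 : r U_(2%:R)%MM = 2%:R.
  by rewrite (scoefU_Bp _ t0 vw) (scoefU_Bm _ v0 w0) X20 X21 X22; ring.
clearbody r; have m1 := nil_Bm v0 tw.
have m2 := nil_Bp v0 tw'; have m3 := nil_Bm v0 tw'.
have d1 : (Bm v (Bm t w)) U_(0%R)%MM - r U_(0%R)%MM \is a GRing.unit.
  rewrite r_0 (scoefU_Bm _ v0 tw) (scoefU_Bm _ t0 w0) X00 X01 X02.
  by rewrite (_ : _ - _ = - 4%:R :> R); [exact: unit4N|ring].
have d2 : (Bp v (Bp t w)) U_(2%:R)%MM - r U_(2%:R)%MM \is a GRing.unit.
  rewrite r_2 (scoefU_Bp _ v0 tw') (scoefU_Bp _ t0 w0) X20 X21 X22.
  by rewrite (_ : _ - _ = - 4%:R :> R); [exact: unit4N|ring].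
have d3 : (Bm v (Bp t w)) U_(0%R)%MM - r U_(0%R)%MM \is a GRing.unit.
  rewrite r_0 (scoefU_Bm _ v0 tw') (scoefU_Bp _ t0 w0) X00 X01 X02.
  by rewrite (_ : _ - _ = - 4%:R :> R); [exact: unit4N|ring].
have E1 := regular_eq m1 r0 d1 E0; have E2 := regular_eq m2 r0 d2 E1.
by have /eqP := regular_eq m3 r0 d3 E2; rewrite subr_eq0 => /eqP.
Qed.

End Pointwise.

(** * From commuting translations to the group law *)

Section Translations.
Variables (R : comUnitRingType) (gr : grading R).
Hypothesis h2 : (2%:R : R) \is a GRing.unit.
Variables (Psi : {mps R[1]}) (F : {poly {mps R[3]}}).
Hypothesis ftlF : formal_ternary_law gr Psi F.

Section Points.
Variable p : nat.
Implicit Types a b c : {mps R[p]}.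

Definition ff a b := msubst [tuple a; b] (ftl_f Psi F).
Definition hf a := msubst [tuple a] (ftl_half Psi F).

Lemma Bp_Bm a b c : a 0%MM = 0 -> b 0%MM = 0 -> c 0%MM = 0 ->
  Bp F c (Bm F a b) = Bp F a (Bm F c b).
Proof.
move=> a0 b0 c0; have t : topnil [tuple a; b; c] by nil.
have X i : (mpsX i : {mps R[3]}) 0%MM = 0 by apply: nilX.
have := congr1 (msubst [tuple a; b; c]) (Bp_Bm_var h2 ftlF).
have Bv u v := nil_Bm ftlF (X u) (X v).
rewrite !BpE !(msubst_comp2 t _ (X _) (Bv _ _)).
rewrite !BmE !(msubst_comp2 t _ (X _) (X _)).
by rewrite msubst_var30 // msubst_var31 // msubst_var32.
Qed.

Lemma nilf : ftl_f Psi F 0%MM = 0.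
Proof.
apply: nil_msubst (nilB ftlF); apply: topnil2;
  apply: nil_msubst (nil_iota ftlF); apply: topnil1; exact: nilX.
Qed.

Lemma ff_Bm_io a b : a 0%MM = 0 -> b 0%MM = 0 ->
  ff a b = Bm F (io Psi a) (io Psi b).
Proof.
move=> a0 b0; have t : topnil [tuple a; b] by nil.
have X i : topnil [tuple (mpsX i : {mps R[2]})].
  by apply: topnil1; apply: nilX.
have ni := nil_iota ftlF.
rewrite /ff /ftl_f msubst_comp2 //; try exact: nil_msubst.
rewrite !msubst_comp1 //; try exact: nilX.
by rewrite msubst_var20 // msubst_var21.
Qed.

(** The rules for iota give B(iota a, iota b) = iota B'(iota a, b), and B'(iota a, b) = B(a, b). *)
Lemma ffE a b : a 0%MM = 0 -> b 0%MM = 0 -> ff a b = io Psi (Bm F a b).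
Proof.
move=> a0 b0; have ia0 := nil_io ftlF a0.
by rewrite ff_Bm_io // (Bm_iy h2 ftlF) // -(Bm_io h2 ftlF) // (ioK ftlF).
Qed.

Lemma ff_ff a b c : a 0%MM = 0 -> b 0%MM = 0 -> c 0%MM = 0 ->
  ff c (ff a b) = ff a (ff c b).
Proof.
have E (u v w : {mps R[p]}) : u 0%MM = 0 -> v 0%MM = 0 -> w 0%MM = 0 ->
    ff w (ff u v) = Bp F w (Bm F u v).
  move=> u0 v0 w0; have uv := nil_Bm ftlF u0 v0; have uv' := nil_io ftlF uv.
  rewrite (ffE u0 v0) ffE // (Bm_iy h2 ftlF) // (ioK ftlF) //.
  exact: (nil_Bp ftlF w0 uv).
by move=> a0 b0 c0; rewrite !E // Bp_Bm.
Qed.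

Lemma nil_ff a b : a 0%MM = 0 -> b 0%MM = 0 -> ff a b 0%MM = 0.
Proof. by move=> a0 b0; apply: nil_msubst nilf; nil. Qed.

(** As sqrt(D) has the factor x, B(0, b) is half of S(0, b), that is iota b. *)
Lemma ff0 b : b 0%MM = 0 -> ff 0 b = b.
Proof.
move=> b0; have z0 := nil0 R p; have t : topnil [tuple 0; b] by nil.
rewrite ffE // -[RHS](ioK ftlF) //; congr (io _ _).
rewrite BmE /ftl_B msubst_CM // msubstB // -/(Sx _ _ _).
have [-> _] := SP_0 ftlF b0.
rewrite /ftl_sqrtD !msubstM // msubst_var20 // mulr0 mul0r subr0.
by rewrite mulrA -mpsC_nat -mpsC_morph mulVr // mpsC1 mul1r.
Qed.

End Points.

Let z : {mps R[1]} := mpsX ord0.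

Lemma ftl_two_lin :
  ftl_two Psi F 0%MM = 0 /\ ftl_two Psi F U_(ord0)%MM = 2%:R.
Proof.
have z0 : z 0%MM = 0 by apply: nilX.
have o0 := nil0 R 1; have iz := nil_io ftlF z0; have io0 := nil_io ftlF o0.
split; first exact: (nil_ff z0 o0).
rewrite -[ftl_two _ _]/(ff z 0) ff_Bm_io // (scoefU_Bm h2 ftlF) //.
rewrite !(scoefU_io ftlF) // scoefX eqxx scoef0 /=; ring.
Qed.

Lemma ftl_two_inv : [/\ ftl_half Psi F 0%MM = 0,
  msubst [tuple ftl_half Psi F] (ftl_two Psi F) = mpsX ord0
  & msubst [tuple ftl_two Psi F] (ftl_half Psi F) = mpsX ord0].
Proof. by have [t0 tU] := ftl_two_lin; apply: comp_invP; rewrite ?tU. Qed.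

Section MoreP.
Variable p : nat.
Implicit Types a b c : {mps R[p]}.

Lemma nil_hf a : a 0%MM = 0 -> hf a 0%MM = 0.
Proof. by case: ftl_two_inv => h0 _ _ a0; apply: nil_msubst h0; nil. Qed.

Lemma ff_hf0 a : a 0%MM = 0 -> ff (hf a) 0 = a.
Proof.
move=> a0; case: ftl_two_inv => h0 E _; have t : topnil [tuple a] by nil.
have := congr1 (msubst [tuple a]) E.
rewrite msubst_comp1 // -/(hf a) msubst_var1 // => E'; rewrite -[RHS]E'.
have ha := nil_hf a0; have t' : topnil [tuple hf a] by nil.
have o0 := nil0 R 1.
by rewrite /ftl_two msubst_comp2 ?nilX // msubst_var1 // msubst0.
Qed.

Definition mu a b := msubst [tuple a; b] (ftl_mu Psi F).

Lemma muE a b : a 0%MM = 0 -> b 0%MM = 0 -> mu a b = ff (hf a) b.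
Proof.
move=> a0 b0; have t : topnil [tuple a; b] by nil.
have X i : (mpsX i : {mps R[2]}) 0%MM = 0 by apply: nilX.
have [h0 _ _] := ftl_two_inv.
have hX : msubst [tuple (mpsX 0 : {mps R[2]})] (ftl_half Psi F) 0%MM = 0.
  by apply: nil_msubst h0; apply: topnil1; apply: nilX.
rewrite /mu /ftl_mu msubst_comp2 // msubst_comp1 //.
by rewrite msubst_var20 // msubst_var21.
Qed.

Lemma nil_mu a b : a 0%MM = 0 -> b 0%MM = 0 -> mu a b 0%MM = 0.
Proof. by move=> a0 b0; rewrite muE // nil_ff // nil_hf. Qed.

Lemma mu0 a : a 0%MM = 0 -> mu a 0 = a.
Proof. by move=> a0; rewrite muE // ff_hf0. Qed.

Lemma mu_left0 a : a 0%MM = 0 -> mu 0 a = a.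
Proof.
move=> a0; have [h0 _ _] := ftl_two_inv.
by rewrite muE // /hf msubst1_0 // ff0.
Qed.

Lemma mu_lcomm a b c : a 0%MM = 0 -> b 0%MM = 0 -> c 0%MM = 0 ->
  mu c (mu a b) = mu a (mu c b).
Proof.
move=> a0 b0 c0; have ab := nil_mu a0 b0; have cb := nil_mu c0 b0.
by rewrite !(muE _ ab, muE _ cb) // !muE // ff_ff //; apply: nil_hf.
Qed.

Lemma mu_comm a b : a 0%MM = 0 -> b 0%MM = 0 -> mu a b = mu b a.
Proof.
move=> a0 b0; have o0 := nil0 R p.
by have := mu_lcomm b0 o0 a0; rewrite !mu0.
Qed.

Lemma mu_assoc a b c : a 0%MM = 0 -> b 0%MM = 0 -> c 0%MM = 0 ->
  mu (mu a b) c = mu a (mu b c).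
Proof.
move=> a0 b0 c0; have ab := nil_mu a0 b0.
by rewrite mu_comm // mu_lcomm // [mu c b]mu_comm.
Qed.

End MoreP.
End Translations.

(** * Homogeneity *)

Section Homogeneity.
Variables (R : comUnitRingType) (gr : grading R).
Hypothesis h2 : (2%:R : R) \is a GRing.unit.

Lemma gr_opp d a : gr d a -> gr d (- a).
Proof. by rewrite -[- a]sub0r; apply: hpartB; apply: hpart0. Qed.

Lemma gr_add d a b : gr d a -> gr d b -> gr d (a + b).
Proof. by move=> ha /gr_opp/(hpartB ha); rewrite opprK. Qed.

Lemma gr_sum d (I : Type) (r : seq I) (P : pred I) (f : I -> R) :
  (forall i, P i -> gr d (f i)) -> gr d (\sum_(i <- r | P i) f i).
Proof.
by move=> h; apply: big_ind => //; [apply: hpart0 | move=> *; apply: gr_add].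
Qed.

Lemma gr_nat k : gr 0 k%:R.
Proof.
elim: k => [|k IH]; first exact: hpart0.
by rewrite mulrS; apply: gr_add => //; apply: hpart1.
Qed.

Lemma gr_exp a k : gr 0 a -> gr 0 (a ^+ k).
Proof.
move=> ha; elim: k => [|k IH]; first exact: hpart1.
by rewrite exprS -[0]addr0; apply: hpartM.
Qed.

(** Doubling the homogeneous components of 1/2 gives a decomposition of 1; by uniqueness the
    component of degree 0 doubles to 1, so it is 1/2 itself. *)
Lemma gr_half : gr 0 (2%:R^-1).
Proof.
have [s [c [hc E]]] := hpart_sum gr (2%:R^-1 : R).
(* The given list of degrees may contain repetitions and may lack 0: [c'] gathers the repeated terms
   and [s'] adds 0. *)
pose c' e := c e *+ count_mem e s; pose s' := undup (0 :: s).
have hc' e : gr e (c' e).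
  rewrite /c'; elim: (count_mem e s) => [|k IH]; first exact: hpart0.
  by rewrite mulrS; apply: gr_add.
have E' : 2%:R^-1 = \sum_(e <- s') c' e.
  rewrite {1}E -big_undup_iterop_count /s' /=; case: ifPn => // n0s.
  by rewrite big_cons {1}/c' (count_memPn n0s) mulr0n add0r.
have hd e : gr e (2%:R * c' e - (e == 0)%:R).
  apply: hpartB; first by rewrite mulr_natl mulr2n; apply: gr_add.
  by case: eqP => [->|_]; [apply: hpart1|apply: hpart0].
have z : \sum_(e <- s') (2%:R * c' e - (e == 0)%:R) = 0.
  rewrite sumrB -mulr_sumr -E' divrr // (big_rem 0) /=; last first.
    by rewrite mem_undup mem_head.
  rewrite big1_seq ?addr0 ?subrr // => e /andP[_].
  by rewrite mem_rem_uniq ?undup_uniq // inE => /andP[/negbTE ->].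
have := hpart_direct (undup_uniq _) hd z; move/(_ 0).
rewrite mem_undup mem_head eqxx => /(_ isT) /eqP; rewrite subr_eq0 => /eqP e0.
have -> : 2%:R^-1 = c' 0 by apply: (mulrI h2); rewrite divrr // e0.
exact: hc'.
Qed.

Lemma homogC n c : gr 0 c -> mps_homog gr 0 (mpsC c : {mps R[n]}).
Proof.
move=> hc m; rewrite scoefC; case: eqP => [->|_]; last exact: hpart0.
by rewrite mdeg0 mulr0 addr0.
Qed.

Lemma homogX n i : mps_homog gr (- 2%:Z) (mpsX i : {mps R[n]}).
Proof.
move=> m; rewrite scoefX; case: eqP => [->|_]; last exact: hpart0.
by rewrite mdeg1; apply: hpart1.
Qed.

Lemma homog0 n d : mps_homog gr d (0 : {mps R[n]}).
Proof. by move=> m; apply: hpart0. Qed.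

Lemma homogB n d (f g : {mps R[n]}) :
  mps_homog gr d f -> mps_homog gr d g -> mps_homog gr d (f - g).
Proof. by move=> hf hg m; apply: hpartB. Qed.

Lemma homogM n d e (f g : {mps R[n]}) :
  mps_homog gr d f -> mps_homog gr e g -> mps_homog gr (d + e) (f * g).
Proof.
move=> hf hg m; rewrite scoefM; apply: gr_sum => k le_km.
have := congr1 (@mdeg _) (submK le_km); rewrite mdegD => E.
have -> : d + e + 2 * (mdeg m)%:Z
    = (d + 2 * (mdeg k)%:Z) + (e + 2 * (mdeg (m - k)%MM)%:Z) by lia.
exact: hpartM.
Qed.

Lemma homog_natM n d k (f : {mps R[n]}) :
  mps_homog gr d f -> mps_homog gr d (k%:R * f).
Proof.
by move=> hf; rewrite -[d]add0r -mpsC_nat; apply: homogM => //;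
  apply: homogC; apply: gr_nat.
Qed.

Lemma homogXn n d k (f : {mps R[n]}) :
  mps_homog gr d f -> mps_homog gr (d *+ k) (f ^+ k).
Proof.
move=> hf; elim: k => [|k IH]; last by rewrite exprS mulrS; apply: homogM.
by rewrite mulr0n expr0 -mpsC1; apply: homogC; apply: hpart1.
Qed.

(** The coefficient of [f] at [a] has degree d + 2|a|, which the degree -2|a| of the product of the
    [g] compensates. *)
Lemma homog_msubst n k d (g : n.-tuple {mps R[k]}) (f : {mps R[n]}) :
  (forall i, mps_homog gr (- 2%:Z) (tnth g i)) -> mps_homog gr d f ->
  mps_homog gr d (msubst g f).
Proof.
move=> hg hf m; rewrite scoef_msubst; apply: gr_sum => a _.
have hp : mps_homog gr (- (2 * (mdeg a)%:Z)) (\prod_(i < n) tnth g i ^+ a i).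
  rewrite mdegE; elim/big_rec2: _ => [|i y2 y1 _ IH].
    by rewrite mulr0 oppr0 -mpsC1; apply: homogC; apply: hpart1.
  have -> : - (2 * (a i + y1)%N%:Z) = (- 2%:Z) *+ a i + - (2 * y1%:Z).
    by rewrite -mulr_natr natz; lia.
  by apply: homogM => //; apply: homogXn.
have -> : d + 2 * (mdeg m)%:Z
  = (d + 2 * (mdeg a)%:Z) + (- (2 * (mdeg a)%:Z) + 2 * (mdeg m)%:Z) by lia.
exact: hpartM.
Qed.

Lemma homog_sqrt1 n (w : {mps R[n]}) :
  mps_homog gr 0 w -> mps_homog gr 0 (sqrt1 w).
Proof.
move=> hw m; rewrite -[sqrt1 w m]/(\sum_(k < _) _) add0r.
apply: gr_sum => k _; rewrite -[2 * _]add0r; apply: hpartM; last first.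
  by have := homogXn k hw; rewrite mul0rn => /(_ m); rewrite add0r.
rewrite half_binom_cbin // -[0]addr0; apply: hpartM.
  case: (cbin k) => j; first exact: gr_nat.
  by apply: gr_opp; exact: (gr_nat j.+1).
have -> : (4%:R ^+ k)^-1 = (2%:R^-1 * 2%:R^-1) ^+ k :> R.
  rewrite -exprVn; congr (_ ^+ k); rewrite -invrM //; congr (_ ^-1); ring.
by apply: gr_exp; rewrite -[0]addr0; apply: hpartM; exact: gr_half.
Qed.

(* The coefficients of a compositional inverse are determined recursively, the
   coefficient of degree [n] being multiplied by the power [c ^ n] of the
   linear coefficient. *)
Lemma homog_left_inv (g h : {mps R[1]}) : g 0%MM = 0 ->
  gr 0 (g U_(ord0)%MM)^-1 -> g U_(ord0)%MM \is a GRing.unit ->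
  mps_homog gr (- 2%:Z) g -> msubst [tuple g] h = mpsX ord0 ->
  mps_homog gr (- 2%:Z) h.
Proof.
move=> g0 gri gu hg E m; rewrite -(mon1_mdeg m); move: (mdeg m) => k {m}.
elim/ltn_ind: k => k IH; rewrite mdeg_mon1.
have := congr1 (fun f : {mps R[1]} => f (mon1 k)) E.
rewrite scoef_msubst_mon1 mdeg_mon1 big_ord_recr /= -/(mps_coef _ _).
rewrite scoef_expr_mon1 // => /(canRL (addKr _)) /(canRL (mulrK (unitrX k gu))).
move=> ->; rewrite -[X in gr X]addr0; apply: hpartM; last first.
  by rewrite -exprVn; apply: gr_exp.
apply: gr_add; last by have := homogX ord0 (mon1 k); rewrite mdeg_mon1; exact.
apply: gr_opp; apply: gr_sum => i _.
have -> : - 2%:Z + 2 * k%:Z = (- 2%:Z + 2 * (mdeg (mon1 i))%:Z)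
    + ((- 2%:Z) *+ i + 2 * (mdeg (mon1 k))%:Z).
  by rewrite !mdeg_mon1 -mulr_natr natz; lia.
by apply: hpartM; [apply: IH|apply: homogXn].
Qed.

Section Law.
Variables (Psi : {mps R[1]}) (F : {poly {mps R[3]}}).
Hypothesis ftlF : formal_ternary_law gr Psi F.

Lemma homog_f : mps_homog gr (- 2%:Z) (ftl_f Psi F).
Proof.
have [_ _ hF] := ftl_series ftlF.
have hX n i := @homogX n i.
have hio : mps_homog gr (- 2%:Z) (iota_of Psi).
  have [_ _ hPsi _] := ftl_involution ftlF.
  by apply: homogB => //; apply: homog_natM.
have t3 : topnil [tuple mpsX 0; mpsX 0; (mpsX 1 : {mps R[2]})].
  by apply: topnil3; apply: nilX.
have hFl l : mps_homog gr (- (2 * l%:Z))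
    (tsubst [tuple mpsX 0; mpsX 0; (mpsX 1 : {mps R[2]})] F)`_l.
  rewrite coef_tsubst //; apply: homog_msubst => [i|]; last exact: hF.
  by case: i => [[|[|[|//]]] lt]; rewrite (tnth_nth 0) /=; apply: hX.
have hS : mps_homog gr (- 2%:Z) (ftl_S F).
  by apply: homogB; [apply: hFl 1%N|apply: homog_natM].
have hP : mps_homog gr (- 4%:Z) (ftl_P F).
  rewrite /ftl_P -mulrA; apply: homogB; first apply: homogB.
  - exact: hFl 2%N.
  - by apply: homog_natM; apply: (@homogM _ (- 2%:Z) (- 2%:Z)).
  - exact: (@homogXn _ (- 2%:Z) 2).
have hD : mps_homog gr (- 4%:Z) (ftl_D F).
  by apply: homogB; [apply: (@homogXn _ (- 2%:Z) 2)|apply: homog_natM].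
have h16 : gr 0 (16%:R^-1).
  have -> : 16%:R^-1 = (2%:R^-1) ^+ 4 :> R.
    by rewrite exprVn; congr (_ ^-1); ring.
  by apply: gr_exp; apply: gr_half.
have hq : mps_homog gr 0 (div_sqr 0 (ftl_D F)).
  move=> m; have := hD (m + U_(0%R) + U_(0%R))%MM; rewrite !mdegD mdeg1.
  rewrite (_ : - 4%:Z + _ = 0 + 2 * (mdeg m)%:Z) //; lia.
have hsq : mps_homog gr (- 2%:Z) (ftl_sqrtD F).
  rewrite /ftl_sqrtD -mulrA; apply: homog_natM.
  rewrite -[- 2%:Z]addr0; apply: homogM => //; apply: homog_sqrt1.
  apply: homogB; last by rewrite -mpsC1; apply: homogC; apply: hpart1.
  by rewrite -[0]addr0; apply: homogM => //; apply: homogC.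
have hB : mps_homog gr (- 2%:Z) (ftl_B F).
  rewrite /ftl_B -[- 2%:Z]add0r; apply: homogM; last exact: homogB.
  by apply: homogC; apply: gr_half.
apply: homog_msubst => // -[[|[|//]] lt]; rewrite (tnth_nth 0) /=;
  by apply: homog_msubst => // i; rewrite (ord1 i); apply: hX.
Qed.

Lemma homog_mu : mps_homog gr (- 2%:Z) (ftl_mu Psi F).
Proof.
have hX n i := @homogX n i; have hf := homog_f.
have h2' : mps_homog gr (- 2%:Z) (ftl_two Psi F).
  apply: homog_msubst => // -[[|[|//]] lt]; rewrite (tnth_nth 0) //=.
  exact: homog0.
have [h0 _ E] := ftl_two_inv h2 ftlF.
have [t0 tU] := ftl_two_lin h2 ftlF.
have hh : mps_homog gr (- 2%:Z) (ftl_half Psi F).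
  (* The linear coefficient of [2] is 2, whose inverse has degree 0. *)
  by apply: homog_left_inv E; rewrite ?tU //; apply: gr_half.
apply: homog_msubst => // -[[|[|//]] lt]; rewrite (tnth_nth 0) //=.
by apply: homog_msubst => // i; rewrite (ord1 i); apply: hX.
Qed.

End Law.
End Homogeneity.

Theorem proposition8p4p5 (R : comUnitRingType) (gr : grading R)
    (h2 : (2%:R : R) \is a GRing.unit)
    (Psi : {mps R[1]}) (F : {poly {mps R[3]}}) :
  formal_ternary_law gr Psi F -> formal_group_law gr (ftl_mu Psi F).
Proof.
move=> ftlF; have X n i : (mpsX i : {mps R[n]}) 0%MM = 0 by apply: nilX.
have o0 := nil0 R 1.
split.
- exact: homog_mu.
- exact: (mu_left0 h2 ftlF (X _ _)).
- exact: (mu0 h2 ftlF (X _ _)).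
- rewrite -[RHS]msubst_id2; exact: (mu_comm h2 ftlF (X _ _) (X _ _)).
move=> x y z; exact: (mu_assoc h2 ftlF (X _ _) (X _ _) (X _ _)).
Qed.
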